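(* Consider the discrete memoryless wiretap channel with causal state information at the encoder and the legitimate decoder and secure rate-limited feedback at rate $R_f$ (as defined in the context). Then the secrecy capacity satisfies \[ C_S\le \max_{p(x|s)}\min\{I(X;Y|Z,S)+H(S|Z)+R_f,\ I(X;Y|S)\}, \] where the joint distribution is $p(s)p(x|s)p(y,z|x,s)$.
   Context: Model: finite alphabets $\mathcal X,\mathcal Y,\mathcal Z,\mathcal S$. A state sequence $S^n$ is i.i.d. with distribution $p(s)$. The channel is memoryless: $p(y_i,z_i|x^i,y^{i-1},z^{i-1},s_i)=p(y_i,z_i|x_i,s_i)$; $Y$ is the legitimate receiver's output, $Z$ the eavesdropper's output. The state is known causally (i.e. $s^i$ at time $i$) to both the encoder and the legitimate decoder. A secure feedback link (not observed by the eavesdropper) from decoder to encoder carries symbols $K^f_i\in\mathcal K^f_i$, $i=1,\dots,n$, with $\frac1n\sum_{i=1}^n\log|\mathcal K^f_i|\le R_f$; $K^f_i$ is generated randomly according to $p(k^f_i|y^{i-1},k_f^{i-1})$, where $k_f^{i-1}=(k^f_1,\dots,k^f_{i-1})$. A $(2^{nR},2^{nR_f},n)$ code consists of a message set $\{1,\dots,2^{nR}\}$ with message $M$ uniform on it, such feedback, a stochastic encoder $p(x_i|m,x^{i-1},s^i,k_f^i)$, and a decoder $\hat m:\mathcal Y^n\times\mathcal S^n\times\mathcal K^n_f\to\{1,\dots,2^{nR}\}$, $\hat M=\hat m(Y^n,S^n,K_f^n)$; $P_e^{(n)}=\Pr(\hat M\ne M)$. A rate $R$ is securely achievable if for every $\varepsilon>0$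 there exists a $(2^{nR},2^{nR_f},n)$ code with $H(M|Z^n)/H(M)\ge 1-\varepsilon$ and $P_e^{(n)}\le\varepsilon$. The secrecy capacity $C_S$ is the supremum of securely achievable rates. *)

(* Defs.v *)
From HB Require Import structures.
From mathcomp Require Import all_boot all_order all_algebra.
From mathcomp Require Import reals exp.
Set Implicit Arguments. Unset Strict Implicit. Unset Printing Implicit Defensive.
Import Order.TTheory GRing.Theory Num.Theory.
Local Open Scope ring_scope.

Section InfoMeasures.
Variable R : realType.

Definition log2 (x : R) : R := ln x / ln 2.

(* Shannon entropy of a pmf on a finite type (0 log 0 = 0 automatically,
   since the term is multiplied by p t = 0) *)
Definition ent (T : finType) (p : T -> R) : R :=
  - \sum_(t : T) p t * log2 (p t).

Definition marg (Om : finType) (B : eqType) (P : Om -> R) (f : Om -> B) (b : B) : R :=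
  \sum_(w : Om | f w == b) P w.

Definition Hrv (Om : finType) (B : finType) (P : Om -> R) (f : Om -> B) : R :=
  ent (marg P f).

Definition condH (Om B C : finType) (P : Om -> R) (f : Om -> B) (g : Om -> C) : R :=
  Hrv P (fun w => (f w, g w)) - Hrv P g.

Definition cmi (Om B C D : finType) (P : Om -> R)
  (f : Om -> B) (g : Om -> C) (h : Om -> D) : R :=
  condH P f h - condH P f (fun w => (g w, h w)).

Definition is_pmf (T : finType) (p : T -> R) : Prop :=
  (forall t, 0 <= p t) /\ \sum_(t : T) p t = 1.

End InfoMeasures.

Section Model.
Variables (R : realType) (X Y Z S : finType).

Definition valid_channel (W : S -> X -> Y -> Z -> R) : Prop :=
  forall s x, is_pmf (fun yz : Y * Z => W s x yz.1 yz.2).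

Definition joint1 (pS : S -> R) (q : S -> X -> R) (W : S -> X -> Y -> Z -> R)
  (w : S * X * Y * Z) : R :=
  let '(s, x, y, z) := w in pS s * q s x * W s x y z.

Definition rvS (w : S * X * Y * Z) : S := let '(s, _, _, _) := w in s.
Definition rvX (w : S * X * Y * Z) : X := let '(_, x, _, _) := w in x.
Definition rvY (w : S * X * Y * Z) : Y := let '(_, _, y, _) := w in y.
Definition rvZ (w : S * X * Y * Z) : Z := let '(_, _, _, z) := w in z.

Definition upper_bound_expr (pS : S -> R) (W : S -> X -> Y -> Z -> R) (Rf : R)
  (q : S -> X -> R) : R :=
  let J := joint1 pS q W in
  Num.min (cmi J rvX rvY (fun w => (rvZ w, rvS w)) + condH J rvS rvZ + Rf)
          (cmi J rvX rvY rvS).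

Definition agree_upto (n : nat) (T : 'I_n -> Type)
  (i : nat) (a b : forall j : 'I_n, T j) : Prop :=
  forall j : 'I_n, (j < i)%N -> a j = b j.

Section Code.
Variables (n : nat) (Mn : nat).

Local Notation seqT T := {ffun 'I_n -> T}.

(* Feedback alphabets K_i = 'I_(kf i); message M in 'I_Mn, i.e. {1,..,Mn}. *)
Local Unset Implicit Arguments.
Record code := Code {
  kf : 'I_n -> nat;
  (* p(k_i | y^{i-1}, k^{i-1}) *)
  fb : forall i : 'I_n, seqT Y -> {dffun forall j : 'I_n, 'I_(kf j)} -> 'I_(kf i) -> R;
  (* p(x_i | m, x^{i-1}, s^i, k^i) *)
  enc : 'I_n -> 'I_Mn -> seqT X -> seqT S -> {dffun forall j : 'I_n, 'I_(kf j)} -> X -> R;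
  dec : seqT Y -> seqT S -> {dffun forall j : 'I_n, 'I_(kf j)} -> 'I_Mn;
  kf_pos : forall i, (0 < kf i)%N;
  fb_pmf : forall i y k, is_pmf (fb i y k);
  fb_causal : forall (i : 'I_n) (y y' : seqT Y)
      (k k' : {dffun forall j : 'I_n, 'I_(kf j)}),
      agree_upto i (fun j => y j) (fun j => y' j) ->
      agree_upto i (fun j => k j) (fun j => k' j) ->
      fb i y k = fb i y' k';
  enc_pmf : forall i m x s k, is_pmf (enc i m x s k);
  enc_causal : forall (i : 'I_n) (m : 'I_Mn) (x x' : seqT X) (s s' : seqT S)
      (k k' : {dffun forall j : 'I_n, 'I_(kf j)}),
      agree_upto i (fun j => x j) (fun j => x' j) ->
      agree_upto i.+1 (fun j => s j) (fun j => s' j) ->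
      agree_upto i.+1 (fun j => k j) (fun j => k' j) ->
      enc i m x s k = enc i m x' s' k'
}.
Local Set Implicit Arguments.

Definition fb_rate_ok (c : code) (Rf : R) : Prop :=
  (n%:R)^-1 * \sum_(i < n) log2 (kf c i)%:R <= Rf.

Definition omega (c : code) : finType :=
  ('I_Mn * seqT S * {dffun forall j : 'I_n, 'I_(kf c j)}
   * seqT X * seqT Y * seqT Z)%type.

(* joint distribution induced by the code, M uniform, S^n i.i.d.,
   memoryless channel *)
Definition code_joint (pS : S -> R) (W : S -> X -> Y -> Z -> R) (c : code)
  (w : omega c) : R :=
  let '(m, s, k, x, y, z) := w in
  (Mn%:R)^-1 *
  \prod_(i < n) (pS (s i) * fb c i y k (k i) * enc c i m x s k (x i)
                 * W (s i) (x i) (y i) (z i)).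
Arguments code_joint pS W c w : clear implicits.

Definition rvM (c : code) (w : omega c) : 'I_Mn := let '(m, _, _, _, _, _) := w in m.
Definition rvZn (c : code) (w : omega c) : seqT Z := let '(_, _, _, _, _, z) := w in z.

Definition err_prob (pS : S -> R) (W : S -> X -> Y -> Z -> R) (c : code) : R :=
  \sum_(w : omega c | let '(m, s, k, x, y, z) := w in dec c y s k != m)
     code_joint pS W c w.

Definition secrecy_ratio (pS : S -> R) (W : S -> X -> Y -> Z -> R) (c : code) : R :=
  let P := code_joint pS W c in
  condH P (@rvM c) (@rvZn c) / Hrv P (@rvM c).

End Code.

Definition msg_size (n : nat) (Rt : R) : nat :=
  `|Num.ceil (powR 2 (n%:R * Rt))|%N.

Definition securely_achievable (pS : S -> R) (W : S -> X -> Y -> Z -> R)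
  (Rf : R) (Rt : R) : Prop :=
  forall eps : R, 0 < eps ->
    exists (n : nat) (c : code n (msg_size n Rt)),
      fb_rate_ok c Rf /\
      1 - eps <= secrecy_ratio pS W c /\
      err_prob pS W c <= eps.

End Model.

(* Main.v *)
Require Import Defs.
From HB Require Import structures.
From mathcomp Require Import boolp classical_sets functions topology normedtype derive realfun.
From mathcomp Require Import all_boot all_order all_algebra.
From mathcomp Require Import reals exp.
From mathcomp Require Import ring lra.
Import Order.TTheory GRing.Theory Num.Theory.
Import numFieldNormedType.Exports.
Local Open Scope ring_scope.
Set Implicit Arguments. Unset Strict Implicit. Unset Printing Implicit Defensive.

(** Secret key argument.  Let [A_i = (M, X^i, S^i, K^i)], [B_i = (Y^i, S^i, K^i)]
    and [Z^i] be the views of the encoder, the decoder and the eavesdropper.  The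
    potential [I(A_i; B_i | Z^i)] starts at 0, dominates [I(M; B_n | Z^n)] at the
    end, and at step [i] grows by at most
    [log |K_i| + H(S_i | Z_i) + I(X_i; Y_i | Z_i, S_i)]: using the potential rather
    than [I(M; B_n | Z^n)] itself copes with the dependence of future inputs on
    past outputs through the feedback.  Similarly [I(M; B_n)] is at most the sum of
    the [I(X_i; Y_i | S_i)].  With Fano's inequality both sums bound the rate, and
    by concavity they are at most [n] times their value at the average input law.
    The slack vanishes in the limit since the bound is continuous on the compact
    set of input laws.

    Submodularity of entropy, Fano's inequality, the bound [log |K_i|] and
    concavity are all instances of Gibbs' inequality [condH_le_cross]; together
    with the product form of the joint law it also replaces all Markov chain
    arguments. *)

(** * Elementary facts on the binary logarithm *)

Section Log.
Variable R : realType.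
Implicit Types x y : R.

Lemma ln2_gt0 : 0 < ln 2 :> R.
Proof. by apply: ln_gt0; lra. Qed.

Lemma log2M x y : 0 < x -> 0 < y -> log2 (x * y) = log2 x + log2 y.
Proof. by move=> x0 y0; rewrite /log2 lnM ?posrE // mulrDl. Qed.

Lemma log2V x : 0 < x -> log2 x^-1 = - log2 x.
Proof. by move=> x0; rewrite /log2 lnV ?posrE // mulNr. Qed.

Lemma log2_le_sub1 x : 0 < x -> log2 x <= (x - 1) / ln 2.
Proof.
move=> x0; rewrite /log2 ler_pM2r ?invr_gt0 ?ln2_gt0 //.
by have := @le_ln1Dx R (x - 1); rewrite addrCA subrr addr0; apply; lra.
Qed.

Lemma ler_log2 x y : 0 < x -> x <= y -> log2 x <= log2 y.
Proof.
move=> x0 xy; rewrite /log2 ler_pM2r ?invr_gt0 ?ln2_gt0 //.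
by rewrite ler_ln ?posrE // (lt_le_trans x0).
Qed.

Lemma log21 : log2 1 = 0 :> R.
Proof. by rewrite /log2 ln1 mul0r. Qed.

Lemma log2_le0 x : x <= 1 -> log2 x <= 0.
Proof. by move=> x1; rewrite /log2 pmulr_lle0 ?invr_gt0 ?ln2_gt0 // ln_le0. Qed.

Lemma log2_prod (I : finType) (F : I -> R) :
  (forall i, 0 < F i) -> log2 (\prod_i F i) = \sum_i log2 (F i).
Proof.
move=> F0; suff [] : log2 (\prod_i F i) = \sum_i log2 (F i) /\ 0 < \prod_i F i by [].
elim/big_rec2: _ => [|i u v _ [<- v0]]; first by rewrite log21.
by rewrite log2M // mulr_gt0.
Qed.

End Log.

(** * Conditional entropy and Gibbs' inequality *)

Section Entropy.
Variables (R : realType) (Om : finType) (P : Om -> R).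
Hypothesis P_ge0 : forall w, 0 <= P w.

Lemma marg_ge0 (B : eqType) (f : Om -> B) b : 0 <= marg P f b.
Proof. exact: sumr_ge0. Qed.

Lemma le_marg (B : eqType) (f : Om -> B) w : P w <= marg P f (f w).
Proof. by rewrite /marg (bigD1 w) //= lerDl sumr_ge0. Qed.

Lemma marg_gt0 (B : eqType) (f : Om -> B) w : 0 < P w -> 0 < marg P f (f w).
Proof. by move=> h; rewrite (lt_le_trans h) // le_marg. Qed.

Lemma sum_marg (B : finType) (f : Om -> B) (F : B -> R) :
  \sum_w P w * F (f w) = \sum_b marg P f b * F b.
Proof.
rewrite (partition_big f xpredT) //=; apply: eq_bigr => b _.
by rewrite /marg mulr_suml; apply: eq_bigr => w /eqP ->.
Qed.

Lemma HrvE (B : finType) (f : Om -> B) :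
  Hrv P f = - \sum_w P w * log2 (marg P f (f w)).
Proof. by rewrite /Hrv /ent (sum_marg f (fun b => log2 (marg P f b))). Qed.

Lemma marg_ker (B B' : eqType) (f : Om -> B) (f' : Om -> B') w :
  (forall w', (f w' == f w) = (f' w' == f' w)) ->
  marg P f (f w) = marg P f' (f' w).
Proof. by move=> e; apply: eq_bigl => w'; rewrite e. Qed.

(** By [HrvE] entropy only sees the partition into fibres, so differently encoded variables can be
    exchanged. *)
Lemma Hrv_ker (B B' : finType) (f : Om -> B) (f' : Om -> B') :
  (forall w w', (f w' == f w) = (f' w' == f' w)) -> Hrv P f = Hrv P f'.
Proof.
move=> e; rewrite !HrvE; congr (- _); apply: eq_bigr => w _.
by rewrite (@marg_ker _ _ f f').
Qed.

Lemma condHE (B C : finType) (f : Om -> B) (g : Om -> C) :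
  condH P f g = - \sum_w P w * (log2 (marg P (fun w => (f w, g w)) (f w, g w))
                                - log2 (marg P g (g w))).
Proof.
rewrite /condH !HrvE -opprD -sumrB; congr (- _).
by apply: eq_bigr => w _; rewrite mulrBr.
Qed.

(** Equality case of Gibbs' inequality: [k] is the true conditional probability of [f] given [g]. *)
Lemma condH_kernel (B C : finType) (f : Om -> B) (g : Om -> C) (k : Om -> R) :
  (forall w, marg P (fun w => (f w, g w)) (f w, g w) = marg P g (g w) * k w) ->
  condH P f g = - \sum_w P w * log2 (k w).
Proof.
move=> kE; rewrite condHE; congr (- _); apply: eq_bigr => w _.
have := P_ge0 w; rewrite le_eqVlt => /predU1P[<-|w0]; first by rewrite !mul0r.
have g0 := marg_gt0 g w0; have h0 := marg_gt0 (fun w => (f w, g w)) w0.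
rewrite /= kE in h0 *; rewrite pmulr_rgt0 // in h0.
by rewrite log2M // addrC addKr.
Qed.

(** Gibbs' inequality: the gap between the sides is a relative entropy, controlled by
    [log2 x <= (x - 1) / ln 2]. The kernel [k] may be substochastic and sees [w] only through
    [g]. *)
Lemma condH_le_cross (B C : finType) (f : Om -> B) (g : Om -> C)
    (k : Om -> B -> R) :
  (forall w b, 0 <= k w b) -> (forall w, \sum_b k w b <= 1) ->
  (forall w w', g w = g w' -> k w =1 k w') ->
  (forall w, 0 < P w -> 0 < k w (f w)) ->
  condH P f g <= - \sum_w P w * log2 (k w (f w)).
Proof.
move=> k0 k1 kg kpos.
(* [kc] reads the kernel as a function of the value of [g]; values never taken get the zero row,
   which is still substochastic. *)
pose kc c b := if [pick w | g w == c] is Some w then k w b else 0.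
have kcE w b : k w b = kc (g w) b.
  rewrite /kc; case: pickP => [w' /eqP e|/(_ w)]; last by rewrite eqxx.
  exact: kg.
have kc0 c b : 0 <= kc c b by rewrite /kc; case: pickP.
have kc1 c : \sum_b kc c b <= 1.
  by rewrite /kc; case: pickP => // _; rewrite big1 ?ler01.
rewrite condHE lerN2.
pose h w := (f w, g w).
(* [F] is the ratio of the law built from [kc] to the true joint law; its mean under [P] is at most
   the mass of [P]. *)
pose F (bc : B * C) := kc bc.2 bc.1 * marg P g bc.2 / marg P h bc.
have -> : \sum_w P w * log2 (k w (f w)) =
   \sum_w P w * (log2 (marg P h (f w, g w)) - log2 (marg P g (g w)))
   + \sum_w P w * (log2 (k w (f w)) + log2 (marg P g (g w))
                    - log2 (marg P h (f w, g w))).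
  by rewrite -big_split; apply: eq_bigr => w _ /=; rewrite -mulrDr; congr (_ * _); lra.
rewrite gerDl (@le_trans _ _ (\sum_w P w * ((F (h w) - 1) / ln 2))) //.
  apply: ler_sum => w _; have := P_ge0 w.
  rewrite le_eqVlt => /predU1P[<-|w0]; first by rewrite !mul0r.
  have g0 := marg_gt0 g w0; have h0 := marg_gt0 h w0; have k00 := kpos w w0.
  rewrite ler_pM2l // /F /= -kcE; apply: le_trans (log2_le_sub1 _).
    by rewrite log2M ?log2M ?log2V ?invr_gt0 ?mulr_gt0.
  by rewrite divr_gt0 ?mulr_gt0.
under eq_bigr do rewrite mulrA mulrBr mulr1.
rewrite -mulr_suml sumrB pmulr_lle0 ?invr_gt0 ?ln2_gt0 // subr_le0.
rewrite (sum_marg h F).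
apply: (@le_trans _ _ (\sum_(bc : B * C) kc bc.2 bc.1 * marg P g bc.2)).
  apply: ler_sum => bc _; rewrite /F.
  have := marg_ge0 h bc; rewrite le_eqVlt => /predU1P[<-|p0].
    by rewrite mul0r mulr_ge0 // marg_ge0.
  by rewrite mulrC divfK // gt_eqF.
rewrite -(pair_bigA _ (fun b c => kc c b * marg P g c)) exchange_big /=.
have -> : \sum_w P w = \sum_c marg P g c.
  by under eq_bigr do rewrite -[P _]mulr1; rewrite (sum_marg g (fun=> 1));
     apply: eq_bigr => c _; rewrite mulr1.
apply: ler_sum => c _; rewrite -mulr_suml ler_piMl ?marg_ge0 //.
Qed.

(** The sum is one unless [marg P g c] vanishes, when division by zero makes every term 0; the
    inequality covers both cases. *)
Lemma sum_cond_law_le1 (B C : finType) (f : Om -> B) (g : Om -> C) c :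
  \sum_b marg P (fun w => (f w, g w)) (b, c) / marg P g c <= 1.
Proof.
rewrite -mulr_suml; have -> : \sum_b marg P (fun w => (f w, g w)) (b, c) = marg P g c.
  rewrite /marg [RHS](partition_big f xpredT) //=; apply: eq_bigr => b _.
  by apply: eq_bigl => w'; rewrite xpair_eqE andbC.
have := marg_ge0 g c; rewrite le_eqVlt => /predU1P[<-|p0]; first by rewrite mul0r ler01.
by rewrite mulfV ?gt_eqF.
Qed.

(** Gibbs' inequality tested against the uniform law. *)
Lemma condH_le_log_card (B C : finType) (f : Om -> B) (g : Om -> C) :
  \sum_w P w = 1 -> condH P f g <= log2 #|B|%:R.
Proof.
move=> P1.
(* If [B] is empty then so is [Om], and both sides are 0. *)
have [B0|Bn0] := posnP #|B|.
  rewrite condHE big1 ?oppr0 ?B0 /log2 ?(ln0 (lexx 0)) ?mul0r // => w.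
  by have := fintype0 (f w) B0.
have B0 : 0 < #|B|%:R :> R by rewrite ltr0n.
apply: le_trans (condH_le_cross (k := fun _ _ => #|B|%:R^-1) _ _ _ _) _ => //.
- by move=> *; rewrite invr_ge0 ltW.
- by move=> w; rewrite sumr_const -[X in X <= _]mulr_natl mulfV ?gt_eqF.
- by rewrite invr_gt0.
- by rewrite -mulr_suml P1 mul1r log2V // opprK.
Qed.

(** Gibbs' inequality tested against the conditional law of [f] given [h], which is also a function
    of [g]. *)
Lemma condH_coarser (B C D : finType) (f : Om -> B) (g : Om -> C) (h : Om -> D) :
  (forall w w', g w = g w' -> h w = h w') -> condH P f g <= condH P f h.
Proof.
move=> gh.
pose fh w := (f w, h w).
pose k w b := marg P fh (b, h w) / marg P h (h w).
have kpos w : 0 < P w -> 0 < k w (f w).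
  by move=> w0; rewrite divr_gt0 ?(marg_gt0 h) ?(marg_gt0 fh).
apply: le_trans (condH_le_cross (k := k) _ _ _ kpos) _.
- by move=> w b; rewrite divr_ge0 ?marg_ge0.
- by move=> w; exact: sum_cond_law_le1.
- by move=> w w' /gh e b; rewrite /k e.
rewrite condHE lerN2; apply: ler_sum => w _.
have := P_ge0 w; rewrite le_eqVlt => /predU1P[<-|w0]; first by rewrite !mul0r.
have h0 := marg_gt0 h w0; have fh0 := marg_gt0 fh w0.
by rewrite /k log2M ?invr_gt0 // log2V.
Qed.

End Entropy.

(** * Entropy as a submodular function of sets of coordinates *)

Section SetEntropy.
Variables (R : realType) (Om : finType) (P : Om -> R).
Hypothesis P_ge0 : forall w, 0 <= P w.
Variables (C V : finType) (val : C -> Om -> V).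

(** Hiding coordinates by [None] gives all subsets one codomain, so that joining views of random
    variables becomes union of sets. *)
Definition restr (A : {set C}) (w : Om) : {ffun C -> option V} :=
  [ffun c => if c \in A then Some (val c w) else None].

Lemma restrP (A : {set C}) w w' :
  reflect (forall c, c \in A -> val c w' = val c w) (restr A w' == restr A w).
Proof.
apply: (iffP eqP) => [/ffunP e c cA|e].
  by have := e c; rewrite !ffunE cA => -[].
by apply/ffunP => c; rewrite !ffunE; case: ifP => // /e ->.
Qed.

Definition setH (A : {set C}) : R := Hrv P (restr A).

Lemma restrU (U A : {set C}) w w' :
  (restr (U :|: A) w' == restr (U :|: A) w) =
  (restr U w' == restr U w) && (restr A w' == restr A w).
Proof.
apply/restrP/andP => [e|[/restrP eU /restrP eA] c].
  by split; apply/restrP => c cUA; apply: e; rewrite inE cUA ?orbT.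
by rewrite inE => /orP[/eU|/eA].
Qed.

Lemma condH_setH (B B' : finType) (f : Om -> B) (g : Om -> B') (U A : {set C}) :
  (forall w w', (f w' == f w) = (restr U w' == restr U w)) ->
  (forall w w', (g w' == g w) = (restr A w' == restr A w)) ->
  condH P f g = setH (U :|: A) - setH A.
Proof.
move=> fE gE; rewrite /condH /setH (Hrv_ker P gE); congr (_ - _).
by apply: Hrv_ker => w w'; rewrite xpair_eqE restrU fE gE.
Qed.

Lemma setH_submod (U A B : {set C}) : A \subset B ->
  setH (U :|: B) - setH B <= setH (U :|: A) - setH A.
Proof.
move=> AB; rewrite -(@condH_setH _ _ (restr U) (restr A) U A) //.
rewrite -(@condH_setH _ _ (restr U) (restr B) U B) //.
apply: condH_coarser => // w w' /eqP/restrP e; apply/eqP/restrP => c cA.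
by apply: e; apply: (subsetP AB).
Qed.

Lemma setH0 : \sum_w P w = 1 -> setH set0 = 0.
Proof.
move=> P1; rewrite /setH HrvE big1 ?oppr0 // => w _.
rewrite [marg _ _ _](_ : _ = 1) ?log21 ?mulr0 // -P1 /marg; apply: eq_bigl => w'.
by apply/restrP => c; rewrite inE.
Qed.

End SetEntropy.

Ltac set_tauto :=
  rewrite !inE; do ! (case: (_ \in _); rewrite /= ?orbT ?orbF //=).
Ltac set_eq := apply/setP => ?; set_tauto.
Ltac set_sub := apply/subsetP => ?; set_tauto.

Lemma telescope_le (R : realType) n (f : nat -> R) (g : 'I_n -> R) :
  (forall i : 'I_n, f i.+1 - f i <= g i) -> f n - f 0%N <= \sum_i g i.
Proof.
by move=> fg; rewrite -telescope_sumr // big_mkord; apply: ler_sum.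
Qed.

(** * One-step increments of the views, from submodularity alone *)

Section Polymatroid.
Variables (R : realType) (C : finType) (H : {set C} -> R).
Hypothesis submod : forall U A B : {set C}, A \subset B ->
  H (U :|: B) - H B <= H (U :|: A) - H A.

(* [m]: message; [xp .. zp]: the past letters; [x .. z]: the present ones. *)
Variables m xp sp kp yp zp x s k y z : {set C}.
Let a := m :|: xp :|: sp :|: kp.
Let b := sp :|: kp :|: yp.

Hypothesis H0 : H set0 = 0.
Variable lk : R.
Hypothesis lkP : forall A, H (k :|: A) - H A <= lk.

(** Chain rule in the order [s], [k], [x], [z], keeping in each conditioning only what the
    corresponding kernel reads. The cost of [k] is bounded by [lk], where the feedback rate
    enters. *)
Lemma step_encoder_view :
  H (m :|: (x :|: xp) :|: (s :|: sp) :|: (k :|: kp) :|: (z :|: zp)) - H (a :|: zp)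
  <= H s + lk + (H (x :|: (a :|: s :|: k)) - H (a :|: s :|: k))
     + (H (z :|: (x :|: s)) - H (x :|: s)).
Proof.
have h1 := submod s (sub0set (a :|: zp)).
have h2 := lkP (s :|: (a :|: zp)).
have h3 : H (x :|: (k :|: (s :|: (a :|: zp)))) - H (k :|: (s :|: (a :|: zp))) <=
          H (x :|: (a :|: s :|: k)) - H (a :|: s :|: k).
  by apply: submod; set_sub.
have h4 : H (z :|: (x :|: (k :|: (s :|: (a :|: zp)))))
          - H (x :|: (k :|: (s :|: (a :|: zp)))) <= H (z :|: (x :|: s)) - H (x :|: s).
  by apply: submod; set_sub.
have -> : m :|: (x :|: xp) :|: (s :|: sp) :|: (k :|: kp) :|: (z :|: zp) =
          z :|: (x :|: (k :|: (s :|: (a :|: zp)))) by rewrite /a; set_eq.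
rewrite setU0 H0 in h1; lra.
Qed.

(** Chain rule in the order [z], [s], [b], [k], [y]. Revealing [s] right after [z] produces the term
    [H(S|Z)], and the past view [b] then costs no more than it does given [zp] alone. *)
Lemma step_decoder_view :
  H ((s :|: sp) :|: (k :|: kp) :|: (y :|: yp) :|: (z :|: zp)) - H (z :|: zp)
    - (H (b :|: zp) - H zp)
  <= (H (s :|: z) - H z) + (H (k :|: b) - H b)
     + (H (y :|: (z :|: s)) - H (z :|: s)).
Proof.
have h1 : H (s :|: (z :|: zp)) - H (z :|: zp) <= H (s :|: z) - H z.
  by apply: submod; set_sub.
have h2 : H (b :|: (s :|: (z :|: zp))) - H (s :|: (z :|: zp)) <= H (b :|: zp) - H zp.
  by apply: submod; set_sub.
have h3 : H (k :|: (b :|: (s :|: (z :|: zp)))) - H (b :|: (s :|: (z :|: zp))) <=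
          H (k :|: b) - H b.
  by apply: submod; set_sub.
have h4 : H (y :|: (k :|: (b :|: (s :|: (z :|: zp))))) -
          H (k :|: (b :|: (s :|: (z :|: zp)))) <= H (y :|: (z :|: s)) - H (z :|: s).
  by apply: submod; set_sub.
have -> : (s :|: sp) :|: (k :|: kp) :|: (y :|: yp) :|: (z :|: zp) =
          y :|: (k :|: (b :|: (s :|: (z :|: zp)))) by rewrite /b; set_eq.
lra.
Qed.

Lemma step_decoder_alone :
  H ((s :|: sp) :|: (k :|: kp) :|: (y :|: yp)) - H b
  <= H s + (H (k :|: b) - H b) + (H (y :|: s) - H s).
Proof.
have h1 := submod s (sub0set b).
have h3 : H (k :|: (s :|: b)) - H (s :|: b) <= H (k :|: b) - H b.
  by apply: submod; set_sub.
have h4 : H (y :|: (k :|: (s :|: b))) - H (k :|: (s :|: b)) <= H (y :|: s) - H s.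
  by apply: submod; set_sub.
have -> : (s :|: sp) :|: (k :|: kp) :|: (y :|: yp) = y :|: (k :|: (s :|: b)).
  by rewrite /b; set_eq.
rewrite setU0 H0 in h1; lra.
Qed.

Lemma step_rest (B : {set C}) :
  m \subset B -> s :|: sp \subset B -> k :|: kp \subset B -> y \subset B ->
  H (B :|: (x :|: xp) :|: (z :|: zp)) - H (B :|: xp :|: zp)
  <= (H (x :|: (a :|: s :|: k)) - H (a :|: s :|: k))
     + (H (z :|: (y :|: (x :|: s))) - H (y :|: (x :|: s))).
Proof.
move=> mB sB kB yB.
have BE : B :|: (m :|: (s :|: sp) :|: (k :|: kp) :|: y) = B.
  by apply/setUidPl; rewrite 3!subUset mB sB kB.
have h1 : H (x :|: (B :|: xp :|: zp)) - H (B :|: xp :|: zp)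
          <= H (x :|: (a :|: s :|: k)) - H (a :|: s :|: k).
  by apply: submod; rewrite -BE /a; set_sub.
have h2 : H (z :|: (x :|: (B :|: xp :|: zp))) - H (x :|: (B :|: xp :|: zp))
          <= H (z :|: (y :|: (x :|: s))) - H (y :|: (x :|: s)).
  by apply: submod; rewrite -BE; set_sub.
have -> : B :|: (x :|: xp) :|: (z :|: zp) = z :|: (x :|: (B :|: xp :|: zp)).
  by set_eq.
lra.
Qed.

End Polymatroid.

(** * The sample space of a code as a family of coordinates *)

Section Coordinates.
Variables (R : realType) (X Y Z S : finType) (n Mn : nat).
Variable c : code R X Y S n Mn.

Local Notation kf := (kf R X Y S n Mn c).
Local Notation Om := (omega Z c).
Local Notation Kseq := {dffun forall j : 'I_n, 'I_(kf j)}.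

Definition seqM (w : Om) : 'I_Mn := w.1.1.1.1.1.
Definition seqS (w : Om) : {ffun 'I_n -> S} := w.1.1.1.1.2.
Definition seqK (w : Om) : Kseq := w.1.1.1.2.
Definition seqX (w : Om) : {ffun 'I_n -> X} := w.1.1.2.
Definition seqY (w : Om) : {ffun 'I_n -> Y} := w.1.2.
Definition seqZ (w : Om) : {ffun 'I_n -> Z} := w.2.

(** One index per scalar random variable, so that the views of the parties are sets of indices. *)
Definition coordinate : finType := (unit + 'I_n + 'I_n + 'I_n + 'I_n + 'I_n)%type.
Definition cM : coordinate := inl (inl (inl (inl (inl tt)))).
Definition cS (i : 'I_n) : coordinate := inl (inl (inl (inl (inr i)))).
Definition cK (i : 'I_n) : coordinate := inl (inl (inl (inr i))).
Definition cX (i : 'I_n) : coordinate := inl (inl (inr i)).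
Definition cY (i : 'I_n) : coordinate := inl (inr i).
Definition cZ (i : 'I_n) : coordinate := inr i.

(** A common value type for all coordinates; the feedback alphabets vary with time, hence the sigma
    type. *)
Definition letters : finType :=
  ('I_Mn + S + {j : 'I_n & 'I_(kf j)} + X + Y + Z)%type.

Definition val_at (d : coordinate) (w : Om) : letters :=
  match d with
  | inl (inl (inl (inl (inl _)))) => inl (inl (inl (inl (inl (seqM w)))))
  | inl (inl (inl (inl (inr i)))) => inl (inl (inl (inl (inr (seqS w i)))))
  | inl (inl (inl (inr i))) =>
      inl (inl (inl (inr (Tagged (fun j => 'I_(kf j)) (seqK w i)))))
  | inl (inl (inr i)) => inl (inl (inr (seqX w i)))
  | inl (inr i) => inl (inr (seqY w i))
  | inr i => inr (seqZ w i)
  end.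

Lemma val_atM w w' : (val_at cM w' == val_at cM w) = (seqM w' == seqM w).
Proof. by []. Qed.
Lemma val_atS i w w' : (val_at (cS i) w' == val_at (cS i) w) = (seqS w' i == seqS w i).
Proof. by []. Qed.
Lemma val_atK i w w' : (val_at (cK i) w' == val_at (cK i) w) = (seqK w' i == seqK w i).
Proof.
apply/eqP/eqP => [[/eqP]|e]; last by rewrite /= e.
by rewrite -/(Tagged (fun j => 'I_(kf j)) _) eq_Tagged => /eqP.
Qed.
Lemma val_atX i w w' : (val_at (cX i) w' == val_at (cX i) w) = (seqX w' i == seqX w i).
Proof. by []. Qed.
Lemma val_atY i w w' : (val_at (cY i) w' == val_at (cY i) w) = (seqY w' i == seqY w i).
Proof. by []. Qed.
Lemma val_atZ i w w' : (val_at (cZ i) w' == val_at (cZ i) w) = (seqZ w' i == seqZ w i).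
Proof. by []. Qed.
Definition val_atE := (val_atM, val_atS, val_atK, val_atX, val_atY, val_atZ).

Definition pre (f : 'I_n -> coordinate) (i : nat) : {set coordinate} :=
  [set f j | j : 'I_n & (j < i)%N].

Lemma pre0 f : pre f 0 = set0.
Proof. by apply/setP => d; rewrite inE; apply/imsetP => -[j]; rewrite inE. Qed.

Lemma preS f (i : 'I_n) : pre f i.+1 = [set f i] :|: pre f i.
Proof.
apply/setP => d; rewrite !inE; apply/imsetP/orP => [[j]|[/eqP ->|/imsetP[j]]].
- rewrite inE ltnS leq_eqVlt => /predU1P[/val_inj ->|ji] ->; first by left.
  by right; apply/imsetP; exists j; rewrite ?inE.
- by exists i; rewrite ?inE.
- by rewrite inE => ji ->; exists j; rewrite ?inE ?(ltn_trans ji).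
Qed.

Local Notation same A w w' := (restr val_at A w' == restr val_at A w).

Lemma same1 d w w' : same [set d] w w' = (val_at d w' == val_at d w).
Proof.
apply/restrP/eqP => [->|e d']; first by [].
  by rewrite inE.
by rewrite inE => /eqP ->.
Qed.

Lemma same_preP f i w w' :
  reflect (forall j : 'I_n, (j < i)%N -> val_at (f j) w' == val_at (f j) w)
          (same (pre f i) w w').
Proof.
apply: (iffP (restrP _ _ _ _)) => [e j ji|e _ /imsetP[j + ->]].
  by apply/eqP/e/imsetP; exists j; rewrite ?inE.
by rewrite inE => /e/eqP.
Qed.

Definition past (i : nat) : {set coordinate} :=
  [set cM] :|: pre cS i :|: pre cK i :|: pre cX i :|: pre cY i :|: pre cZ i.

Definition letter (i : 'I_n) (w : Om) : S * 'I_(kf i) * X * Y * Z :=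
  (seqS w i, seqK w i, seqX w i, seqY w i, seqZ w i).

Lemma same_pastP i w w' :
  reflect (seqM w' = seqM w /\ forall j : 'I_n, (j < i)%N -> letter j w' = letter j w)
          (same (past i) w w').
Proof.
rewrite /past !restrU same1 val_atM -!andbA.
apply: (iffP andP) => [[/eqP mE /and5P[/same_preP sE /same_preP kE /same_preP xE
  /same_preP yE /same_preP zE]]|[mE lE]].
  split=> // j ji; rewrite /letter.
  have /eqP-> : seqS w' j == seqS w j by rewrite -val_atS sE.
  have /eqP-> : seqK w' j == seqK w j by rewrite -val_atK kE.
  have /eqP-> : seqX w' j == seqX w j by rewrite -val_atX xE.
  have /eqP-> : seqY w' j == seqY w j by rewrite -val_atY yE.
  by have /eqP-> : seqZ w' j == seqZ w j by rewrite -val_atZ zE.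
split; first by rewrite mE.
by apply/and5P; split; apply/same_preP => j /lE[]*; rewrite val_atE; apply/eqP.
Qed.

Lemma omega_ext (w w' : Om) :
  seqM w' = seqM w -> (forall j, letter j w' = letter j w) -> w' = w.
Proof.
case: w => [[[[[m s] k] x] y] z]; case: w' => [[[[[m' s'] k'] x'] y'] z'].
rewrite /letter /seqM /seqS /seqK /seqX /seqY /seqZ /= => -> lE.
congr (_, _, _, _, _, _); apply/ffunP => j; by have [] := lE j.
Qed.

(** A representative of the cylinder that extends the past of [w] by the letter [a]; later letters
    are inherited from [w]. *)
Definition upd (w : Om) (i : 'I_n) (a : S * 'I_(kf i) * X * Y * Z) : Om :=
  (seqM w,
   [ffun j => if j == i then a.1.1.1.1 else seqS w j],
   finfun (dfwith (fun j => seqK w j) a.1.1.1.2),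
   [ffun j => if j == i then a.1.1.2 else seqX w j],
   [ffun j => if j == i then a.1.2 else seqY w j],
   [ffun j => if j == i then a.2 else seqZ w j]).

Lemma letter_upd_id w i (a : S * 'I_(kf i) * X * Y * Z) : letter i (upd w a) = a.
Proof.
case: a => [[[[s k] x] y] z].
rewrite /letter /seqM /seqS /seqK /seqX /seqY /seqZ /= !ffunE eqxx.
by rewrite dfwith_in.
Qed.

Lemma letter_upd_neq w i (a : S * 'I_(kf i) * X * Y * Z) j :
  j != i -> letter j (upd w a) = letter j w.
Proof.
move=> ji; rewrite /letter [seqS _]/seqS [seqK _]/seqK [seqX _]/seqX.
by rewrite [seqY _]/seqY [seqZ _]/seqZ /= !ffunE (negbTE ji) dfwith_out // eq_sym.
Qed.

(** Cuts the cylinder of [past i] into cylinders of [past i.+1], one per letter [a]; all summations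
    over the future rest on this. *)
Lemma same_upd w w' (i : 'I_n) (a : S * 'I_(kf i) * X * Y * Z) :
  same (past i) w w' && (letter i w' == a) = same (past i.+1) (upd w a) w'.
Proof.
apply/andP/same_pastP => [[/same_pastP[mE lE] /eqP la]|[mE lE]].
  split=> // j; rewrite ltnS leq_eqVlt => /predU1P[/val_inj ->|ji].
    by rewrite letter_upd_id.
  by rewrite letter_upd_neq ?lE // -val_eqE ltn_eqF.
split; last by rewrite lE // letter_upd_id.
apply/same_pastP; split=> // j ji; rewrite lE ?(ltnW ji) // ?ltnS ?(ltnW ji) //.
by rewrite letter_upd_neq // -val_eqE ltn_eqF.
Qed.

End Coordinates.

(** * The law induced by a code: causality, cylinders and letter laws *)

Section CodeLaw.
Variables (R : realType) (X Y Z S : finType) (n Mn : nat).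
Variable c : code R X Y S n Mn.
Variables (pS : S -> R) (W : S -> X -> Y -> Z -> R).
Hypotheses (pS_pmf : is_pmf pS) (W_pmf : valid_channel W).

Local Notation kf := (kf R X Y S n Mn c).
Local Notation fb := (fb R X Y S n Mn c).
Local Notation enc := (enc R X Y S n Mn c).
Local Notation Om := (omega Z c).
Local Notation P := (@code_joint R X Y Z S n Mn pS W c).
Local Notation same A w w' :=
  (restr (@val_at R X Y Z S n Mn c) A w' == restr (@val_at R X Y Z S n Mn c) A w).

Local Notation upd_at i w := (@upd R X Y Z S n Mn c w i).

Definition pX (i : 'I_n) (w : Om) : X -> R :=
  enc i (seqM w) (seqX w) (seqS w) (seqK w).
Definition pK (i : 'I_n) (w : Om) : 'I_(kf i) -> R := fb i (seqY w) (seqK w).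
Arguments pK : clear implicits.

Definition factor (i : 'I_n) (w : Om) : R :=
  pS (seqS w i) * pK i w (seqK w i) * pX i w (seqX w i)
  * W (seqS w i) (seqX w i) (seqY w i) (seqZ w i).

Lemma code_jointE w : P w = Mn%:R^-1 * \prod_i factor i w.
Proof. by case: w => [[[[[m s] k] x] y] z]. Qed.

Lemma factor_ge0 i w : 0 <= factor i w.
Proof.
rewrite /factor !mulr_ge0 //; first exact: (pS_pmf.1).
- exact: (fb_pmf _ _ _ _ _ _ c _ _ _).1.
- exact: (enc_pmf _ _ _ _ _ _ c _ _ _ _ _).1.
- exact: ((W_pmf _ _).1 (_, _)).
Qed.

Lemma code_joint_ge0 w : 0 <= P w.
Proof. by rewrite code_jointE mulr_ge0 ?invr_ge0 ?prodr_ge0 // => i _; exact: factor_ge0. Qed.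

Lemma pK_causal (i : 'I_n) w w' :
  (forall j : 'I_n, (j < i)%N -> seqY w' j = seqY w j) ->
  (forall j : 'I_n, (j < i)%N -> seqK w' j = seqK w j) -> pK i w' = pK i w.
Proof. by move=> yE kE; apply: fb_causal. Qed.

Lemma pX_causal (i : 'I_n) w w' : seqM w' = seqM w ->
  (forall j : 'I_n, (j < i)%N -> seqX w' j = seqX w j) ->
  (forall j : 'I_n, (j <= i)%N -> seqS w' j = seqS w j) ->
  (forall j : 'I_n, (j <= i)%N -> seqK w' j = seqK w j) -> pX i w' = pX i w.
Proof. by move=> mE xE sE kE; rewrite /pX mE; apply: enc_causal. Qed.

Lemma factor_causal (i : 'I_n) w w' : same (past n i.+1) w w' -> factor i w' = factor i w.
Proof.
move=> /same_pastP[mE lE]; rewrite /factor.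
have [-> <- -> -> ->] := lE i (leqnn _).
rewrite (@pK_causal i w w'); first last.
- by move=> j ji; have [] := lE j (ltnW ji).
- by move=> j ji; have [] := lE j (ltnW ji).
rewrite (@pX_causal i w w') // => j ji.
- by have [] := lE j (ltnW ji).
- by have [] := lE j ji.
- by have [] := lE j ji.
Qed.

(** The probability of the cylinder of [w] up to time [i], as [sum_same_past] shows. *)
Definition prefix_law (i : nat) (w : Om) : R :=
  Mn%:R^-1 * \prod_(j < n | (j < i)%N) factor j w.

Lemma same_past_leq i j w w' : (i <= j)%N -> same (past n j) w w' -> same (past n i) w w'.
Proof.
move=> ij /same_pastP[mE lE]; apply/same_pastP; split=> // t ti.
by rewrite lE // (leq_trans ti).
Qed.

Lemma prefix_law_same i w w' : same (past n i) w w' -> prefix_law i w' = prefix_law i w.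
Proof.
move=> ww'; congr (_ * _); apply: eq_bigr => j ji.
by apply: factor_causal; apply: same_past_leq ww'.
Qed.

Lemma prefix_lawS (i : 'I_n) w : prefix_law i.+1 w = prefix_law i w * factor i w.
Proof.
rewrite /prefix_law (bigD1 i) //= mulrCA mulrC; congr (_ * _ * _).
by apply: eq_bigl => j; rewrite ltnS [in RHS]ltn_neqAle andbC.
Qed.

Lemma same_upd_past (i : 'I_n) w (a : S * 'I_(kf i) * X * Y * Z) : same (past n i) w (upd_at i w a).
Proof.
by have := same_upd w (upd_at i w a) a; rewrite eqxx => /andP[].
Qed.

(** Feedback at time [i] reads strictly earlier letters, so [pK] is taken at [w]; the encoder also
    reads the new [s] and [k], so [pX] stays at the updated point. *)
Lemma factor_upd (i : 'I_n) w s (k : 'I_(kf i)) x y z :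
  factor i (upd_at i w (s, k, x, y, z)) =
  pS s * pK i w k * pX i (upd_at i w (s, k, x, y, z)) x * W s x y z.
Proof.
rewrite /factor; have [-> -> -> -> ->] := letter_upd_id w (s, k, x, y, z).
rewrite (@pK_causal i w) // => j ji.
  have ne : j != i by rewrite -val_eqE ltn_eqF.
  by have [] := letter_upd_neq w (s, k, x, y, z) ne.
have ne : j != i by rewrite -val_eqE ltn_eqF.
by have [] := letter_upd_neq w (s, k, x, y, z) ne.
Qed.

Lemma pX_upd (i : 'I_n) w s (k : 'I_(kf i)) x y z x' y' z' :
  pX i (upd_at i w (s, k, x, y, z)) = pX i (upd_at i w (s, k, x', y', z')).
Proof.
apply: pX_causal => // j ji.
have ne : j != i by rewrite -val_eqE ltn_eqF.
have [_ _ -> _ _] := letter_upd_neq w (s, k, x, y, z) ne.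
by have [_ _ -> _ _] := letter_upd_neq w (s, k, x', y', z') ne.
Qed.

Lemma sum_W s x : \sum_y \sum_z W s x y z = 1.
Proof. by rewrite pair_bigA /=; have [_] := W_pmf s x. Qed.

(** Sum in reverse order of generation: outputs, input, feedback symbol, state, each kernel summing
    to one. *)
Lemma sum_factor_upd (i : 'I_n) w : \sum_a factor i (upd_at i w a) = 1.
Proof.
rewrite -(pair_bigA _ (fun a z => factor i (upd_at i w (a, z)))) /=.
rewrite -(pair_bigA _ (fun a y => \sum_z factor i (upd_at i w (a, y, z)))) /=.
rewrite -(pair_bigA _ (fun a x => \sum_y \sum_z factor i (upd_at i w (a, x, y, z)))) /=.
rewrite -(pair_bigA _ (fun a k => \sum_x \sum_y \sum_z factor i (upd_at i w (a, k, x, y, z)))) /=.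
rewrite -pS_pmf.2; apply: eq_bigr => s _.
rewrite -[RHS]mulr1 -(fb_pmf _ _ _ _ _ _ c i (seqY w) (seqK w)).2 mulr_sumr.
apply: eq_bigr => k _.
(* The encoder law at time [i] ignores the letters [x], [y], [z] of that time; putting back those of
   [w] frees it from the inner summation variables. *)
transitivity (pS s * fb i (seqY w) (seqK w) k *
  \sum_x enc i (seqM w) (seqX w) (seqS (upd_at i w (s, k, seqX w i, seqY w i, seqZ w i)))
     (seqK (upd_at i w (s, k, seqX w i, seqY w i, seqZ w i))) x); last first.
  by rewrite (enc_pmf _ _ _ _ _ _ c i _ _ _ _).2 mulr1.
rewrite mulr_sumr; apply: eq_bigr => x _.
rewrite -[RHS]mulr1 -(sum_W s x) mulr_sumr; apply: eq_bigr => y _.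
rewrite mulr_sumr; apply: eq_bigr => z _.
rewrite factor_upd (pX_upd _ _ _ _ _ _ (seqX w i) (seqY w i) (seqZ w i)).
congr (_ * _ * _); rewrite /pX; congr (enc _ _ _ _ _ _).
by apply/ffunP => j; rewrite /seqX /= ffunE; case: eqP => // ->.
Qed.

Lemma sum_same_past (i : nat) w : (i <= n)%N ->
  \sum_(w' | same (past n i) w w') P w' = prefix_law i w.
Proof.
(* Induction on the remaining time [d = n - i]; at [d = 0] the cylinder is a single point. *)
move=> le_in; rewrite -(subKn le_in); move: (n - i)%N (leq_subr i n) w => d.
elim: d => [|d IHd] dn w.
  rewrite subn0 (big_pred1 w) => [|w'].
    by rewrite code_jointE; congr (_ * _); apply: eq_bigl => j; rewrite ltn_ord.
  apply/same_pastP/eqP => [[mE lE]|-> //].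
  by apply: omega_ext => // j; apply: lE; exact: ltn_ord.
have lt_i : (n - d.+1 < n)%N by rewrite -subSn // subSS leq_subr.
pose i0 : 'I_n := Ordinal lt_i; have iS : (n - d)%N = i0.+1 by rewrite /= -subSn.
rewrite (partition_big (letter i0) xpredT) //=.
transitivity (\sum_a prefix_law i0 w * factor i0 (upd_at i0 w a)).
  apply: eq_bigr => a _; rewrite (eq_bigl (fun w' => same (past n i0.+1) (upd_at i0 w a) w')).
    rewrite -iS IHd ?(ltnW dn) // iS prefix_lawS; congr (_ * _).
    exact/prefix_law_same/same_upd_past.
  by move=> w'; rewrite -same_upd.
by rewrite -mulr_sumr sum_factor_upd mulr1.
Qed.

Lemma sum_same_past_letter (i : 'I_n) (phi : Om -> R) w :
  (forall w w', same (past n i.+1) w w' -> phi w' = phi w) ->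
  \sum_(w' | same (past n i) w w') P w' * phi w' =
  prefix_law i w * \sum_a factor i (upd_at i w a) * phi (upd_at i w a).
Proof.
move=> phiP; rewrite (partition_big (letter i) xpredT) //= mulr_sumr.
apply: eq_bigr => a _.
rewrite (eq_bigl (fun w' => same (past n i.+1) (upd_at i w a) w')); last first.
  by move=> w'; rewrite -same_upd.
under eq_bigr => w' ww' do rewrite (phiP _ _ ww').
rewrite -mulr_suml sum_same_past // prefix_lawS mulrA; congr (_ * _ * _).
exact/prefix_law_same/same_upd_past.
Qed.

Lemma upd_same (i : 'I_n) w w' (a : S * 'I_(kf i) * X * Y * Z) :
  same (past n i) w w' -> same (past n i.+1) (upd_at i w a) (upd_at i w' a).
Proof.
move=> ww'; rewrite -same_upd letter_upd_id eqxx andbT.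
have := same_upd_past w' a => /eqP ->; exact: ww'.
Qed.

(** Tower property: on each cylinder of [past i], the factors at the updated points form the
    conditional law of the next letter. *)
Lemma expect_letter (i : 'I_n) (phi : Om -> R) :
  (forall w w', same (past n i.+1) w w' -> phi w' = phi w) ->
  \sum_w P w * phi w = \sum_w P w * \sum_a factor i (upd_at i w a) * phi (upd_at i w a).
Proof.
move=> phiP; pose h := restr (@val_at R X Y Z S n Mn c) (past n i).
rewrite (partition_big h xpredT) // [RHS](partition_big h xpredT) //=.
apply: eq_bigr => b _.
have [w /eqP <-|b0] := pickP (fun w => h w == b); last by rewrite !big_pred0.
rewrite sum_same_past_letter //.
rewrite [in LHS]mulr_sumr.
transitivity (\sum_(w' | h w' == h w) P w' * \sum_a factor i (upd_at i w a) * phi (upd_at i w a)).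
  by rewrite -mulr_suml sum_same_past ?(ltnW (ltn_ord i)) // mulr_sumr.
apply: eq_bigr => w' ww'; congr (_ * _); apply: eq_bigr => a _.
have e := upd_same a ww'.
by rewrite (phiP _ _ e) (factor_causal e).
Qed.

Lemma rvME (w : Om) : rvM w = seqM w :> 'I_Mn.
Proof. by case: w => [[[[[m s] k] x] y] z]. Qed.

(** The event is a cylinder of [past 0], where the product of factors is empty; [w0] supplies the
    other components of a point in it. *)
Lemma marg_message (w0 : Om) m : marg P (@rvM R X Y Z S n Mn c) m = Mn%:R^-1.
Proof.
pose w : Om := (m, seqS w0, seqK w0, seqX w0, seqY w0, seqZ w0).
have := @sum_same_past 0 w (leq0n _); rewrite /prefix_law big_pred0_eq mulr1 => <-.
apply: eq_bigl => w'; rewrite rvME; apply/eqP/same_pastP => [->|[-> _]] //.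
Qed.

Lemma code_joint_sum1 (w0 : Om) : \sum_w P w = 1.
Proof.
under eq_bigr do rewrite -[P _]mulr1.
rewrite (sum_marg P (@rvM R X Y Z S n Mn c) (fun=> 1)).
under eq_bigr do rewrite (marg_message w0) mulr1.
rewrite sumr_const card_ord -[LHS]mulr_natr mulVf // pnatr_eq0 -lt0n.
exact: leq_ltn_trans (ltn_ord (seqM w0)).
Qed.

Lemma Hrv_message (w0 : Om) : Hrv P (@rvM R X Y Z S n Mn c) = log2 Mn%:R.
Proof.
have M0 : 0 < Mn%:R :> R by rewrite ltr0n (leq_ltn_trans _ (ltn_ord (seqM w0))).
rewrite HrvE; under eq_bigr do rewrite (marg_message w0).
by rewrite -mulr_suml (code_joint_sum1 w0) mul1r log2V // opprK.
Qed.

(* [letter_input i s] is the law of [X_i] given [S_i = s], obtained by averaging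
   the randomised encoder over its other inputs; it makes sense even if
   [pS s = 0]. *)
Definition letter_input (i : 'I_n) (s : S) (x : X) : R :=
  \sum_w P w * \sum_k pK i w k * pX i (upd_at i w (s, k, seqX w i, seqY w i, seqZ w i)) x.

Lemma letter_input_pmf (w0 : Om) i s : is_pmf (letter_input i s).
Proof.
split=> [x|].
  apply: sumr_ge0 => w _; rewrite mulr_ge0 ?code_joint_ge0 // sumr_ge0 // => k _.
  rewrite mulr_ge0 //; first exact: (fb_pmf _ _ _ _ _ _ c _ _ _).1.
  exact: (enc_pmf _ _ _ _ _ _ c _ _ _ _ _).1.
rewrite exchange_big /= -(code_joint_sum1 w0); apply: eq_bigr => w _.
rewrite -mulr_sumr exchange_big /= [X in _ * X](_ : _ = 1) ?mulr1 //.
rewrite -(fb_pmf _ _ _ _ _ _ c i (seqY w) (seqK w)).2; apply: eq_bigr => k _.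
by rewrite -mulr_sumr (enc_pmf _ _ _ _ _ _ c _ _ _ _ _).2 mulr1.
Qed.

Definition letter4 (i : 'I_n) (w : Om) : S * X * Y * Z :=
  (seqS w i, seqX w i, seqY w i, seqZ w i).

(** After resampling time [i], summing out the feedback symbol turns the mean of [pK] times [pX]
    into [letter_input]; the factors [pS] and [W] do not depend on the past and come out of the
    mean. *)
Lemma expect_letter4 (i : 'I_n) (phi : S * X * Y * Z -> R) :
  \sum_w P w * phi (letter4 i w) = \sum_u joint1 pS (letter_input i) W u * phi u.
Proof.
rewrite (@expect_letter i (fun w => phi (letter4 i w))); last first.
  by move=> w w' /same_pastP[_ /(_ i (leqnn _))[e1 _ e3 e4 e5]]; rewrite /letter4 e1 e3 e4 e5.
transitivity (\sum_w \sum_(u : S * X * Y * Z) P w * (\sum_k pK i w k *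
    pX i (upd_at i w (u.1.1.1, k, seqX w i, seqY w i, seqZ w i)) u.1.1.2) *
    (pS u.1.1.1 * W u.1.1.1 u.1.1.2 u.1.2 u.2 * phi u)).
  apply: eq_bigr => w _; rewrite mulr_sumr.
  under [RHS]eq_bigr do rewrite -mulrA mulr_suml mulr_sumr.
  rewrite [RHS]pair_bigA /=.
  rewrite (reindex (fun p : (S * X * Y * Z) * 'I_(kf i) =>
     (p.1.1.1.1, p.2, p.1.1.1.2, p.1.1.2, p.1.2))) /=; last first.
    exists (fun a => ((a.1.1.1.1, a.1.1.2, a.1.2, a.2), a.1.1.1.2)).
      by move=> [[[[s x] y] z] k].
    by move=> [[[[s k] x] y] z].
  apply: eq_bigr => -[[[[s x] y] z] k] _ /=.
  rewrite factor_upd (pX_upd _ _ _ _ _ _ (seqX w i) (seqY w i) (seqZ w i)).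
  rewrite [letter4 _ _](_ : _ = (s, x, y, z)); first by ring.
  by have [e1 _ e3 e4 e5] := letter_upd_id w (s, k, x, y, z); rewrite /letter4 e1 e3 e4 e5.
rewrite exchange_big /=; apply: eq_bigr => -[[[s x] y] z] _ /=.
by rewrite -mulr_suml -/(letter_input i s x); ring.
Qed.

End CodeLaw.

(** * Secrecy and reliability bounds for a block code *)

Section Converse.
Variables (R : realType) (X Y Z S : finType) (n Mn : nat).
Variable c : code R X Y S n Mn.
Variables (pS : S -> R) (W : S -> X -> Y -> Z -> R).
Hypotheses (pS_pmf : is_pmf pS) (W_pmf : valid_channel W).

Local Notation kf := (kf R X Y S n Mn c).
Local Notation Om := (omega Z c).
Variable w0 : Om.
Local Notation P := (@code_joint R X Y Z S n Mn pS W c).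
Local Notation val := (@val_at R X Y Z S n Mn c).
Local Notation same A w w' := (restr val A w' == restr val A w).
Local Notation pK := (@pK R X Y Z S n Mn c).
Local Notation pX := (@pX R X Y Z S n Mn c).
Local Notation H := (setH P val).

Let P_ge0 w : 0 <= P w. Proof. exact: code_joint_ge0. Qed.
Let P_sum1 : \sum_w P w = 1. Proof. exact: code_joint_sum1 w0. Qed.

Let H_submod (U A B : {set coordinate n}) : A \subset B ->
  H (U :|: B) - H B <= H (U :|: A) - H A.
Proof. exact: setH_submod. Qed.
Let H_set0 : H set0 = 0. Proof. exact: setH0. Qed.

Definition WZ s x z := \sum_y W s x y z.
Definition WY s x y := \sum_z W s x y z.

(** Mean log-losses of the true kernels. Gibbs' inequality bounds entropy increments by them, and
    those of [S], [K], [X] and [(Y, Z)] compose the joint entropy exactly ([setH_past]). *)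
Definition crossS (i : 'I_n) := - \sum_w P w * log2 (pS (seqS w i)).
Definition crossK (i : 'I_n) := - \sum_w P w * log2 (pK w (seqK w i)).
Definition crossX (i : 'I_n) := - \sum_w P w * log2 (pX i w (seqX w i)).
Definition crossYZ (i : 'I_n) :=
  - \sum_w P w * log2 (W (seqS w i) (seqX w i) (seqY w i) (seqZ w i)).
Definition crossZ (i : 'I_n) := - \sum_w P w * log2 (WZ (seqS w i) (seqX w i) (seqZ w i)).
Definition crossY (i : 'I_n) := - \sum_w P w * log2 (WY (seqS w i) (seqX w i) (seqY w i)).

Lemma code_joint_gt0 w : 0 < P w -> 0 < Mn%:R :> R /\ forall i : 'I_n,
  [/\ 0 < pS (seqS w i), 0 < pK w (seqK w i), 0 < pX i w (seqX w i)
    & 0 < W (seqS w i) (seqX w i) (seqY w i) (seqZ w i)].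
Proof.
rewrite code_jointE => w_gt0.
split=> [|i].
  by rewrite lt_def ler0n andbT; apply: contraTneq w_gt0 => ->; rewrite invr0 mul0r ltxx.
have F0 : factor pS W i w != 0.
  by apply: contraTneq w_gt0 => e; rewrite (bigD1 i) //= e mul0r mulr0 ltxx.
move: F0; rewrite /factor !mulf_eq0 !negb_or -!andbA => /and4P[a1 a2 a3 a4].
split; rewrite lt_def ?a1 ?a2 ?a3 ?a4 /=; first exact: pS_pmf.1.
- exact: (fb_pmf _ _ _ _ _ _ c _ _ _).1.
- exact: (enc_pmf _ _ _ _ _ _ c _ _ _ _ _).1.
- exact: ((W_pmf _ _).1 (_, _)).
Qed.

Lemma W_ge0 s x y z : 0 <= W s x y z.
Proof. exact: ((W_pmf s x).1 (y, z)). Qed.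

(** Logarithm of the product form of the law. Subtracting this exact value cancels [crossS],
    [crossK] and [crossX] in the bounds below. *)
Lemma setH_past : H (past n n) =
  log2 Mn%:R + \sum_i (crossS i + crossK i + crossX i + crossYZ i).
Proof.
rewrite /setH HrvE.
have -> : \sum_i (crossS i + crossK i + crossX i + crossYZ i) =
   - \sum_w P w * \sum_i (log2 (pS (seqS w i)) + log2 (pK w (seqK w i))
        + log2 (pX i w (seqX w i))
        + log2 (W (seqS w i) (seqX w i) (seqY w i) (seqZ w i))).
  under [in RHS]eq_bigr do rewrite mulr_sumr.
  rewrite exchange_big /= -sumrN; apply: eq_bigr => i _.
  rewrite /crossS /crossK /crossX /crossYZ -!opprD -!big_split /=; congr (- _).
  by apply: eq_bigr => w _; ring.
have -> : log2 Mn%:R = \sum_w log2 Mn%:R * P w by rewrite -mulr_sumr P_sum1 mulr1.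
rewrite -sumrB -sumrN; apply: eq_bigr => w _.
have := P_ge0 w; rewrite le_eqVlt => /predU1P[<-|w_gt0]; first by rewrite !mul0r mulr0 subr0 oppr0.
rewrite /marg (sum_same_past pS_pmf W_pmf w (leqnn n)) /prefix_law.
rewrite (eq_bigl xpredT) => [|i]; last by rewrite ltn_ord.
have [M_gt0 pos] := code_joint_gt0 w_gt0.
have F_gt0 i : 0 < factor pS W i w.
  by have [? ? ? ?] := pos i; rewrite /factor !mulr_gt0.
rewrite log2M ?invr_gt0 ?prodr_gt0 // log2V // log2_prod //.
rewrite [in RHS](eq_bigr (fun i => log2 (factor pS W i w))); first by ring.
move=> i _; have [? ? ? ?] := pos i.
by rewrite /factor !log2M ?mulr_gt0.
Qed.

Lemma same_seqS i w w' : (seqS w' i == seqS w i) = same [set cS i] w w'.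
Proof. by rewrite same1 val_atE. Qed.
Lemma same_seqK i w w' : (seqK w' i == seqK w i) = same [set cK i] w w'.
Proof. by rewrite same1 val_atE. Qed.
Lemma same_seqX i w w' : (seqX w' i == seqX w i) = same [set cX i] w w'.
Proof. by rewrite same1 val_atE. Qed.
Lemma same_seqY i w w' : (seqY w' i == seqY w i) = same [set cY i] w w'.
Proof. by rewrite same1 val_atE. Qed.
Lemma same_seqZ i w w' : (seqZ w' i == seqZ w i) = same [set cZ i] w w'.
Proof. by rewrite same1 val_atE. Qed.

Lemma restr_eq (A : {set coordinate n}) w w' d :
  restr val A w = restr val A w' -> d \in A -> val d w == val d w'.
Proof. by move=> /eqP/restrP e dA; apply/eqP/e. Qed.

Local Notation xs i := ([set cX i] :|: [set cS i]).
Definition encView i := [set cM n] :|: pre (@cX n) i :|: pre (@cS n) i :|: pre (@cK n) i.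
Definition decView i := pre (@cS n) i :|: pre (@cK n) i :|: pre (@cY n) i.
Definition eveView i := pre (@cZ n) i.

Lemma mem_pre (f : 'I_n -> coordinate n) (i : nat) (j : 'I_n) : (j < i)%N -> f j \in pre f i.
Proof. by move=> ji; apply/imsetP; exists j; rewrite ?inE. Qed.

Lemma setH_crossS i : H [set cS i] <= crossS i.
Proof.
have := condH_le_cross P_ge0 (f := fun w : Om => seqS w i) (g := restr val set0)
  (k := fun _ => pS).
rewrite (condH_setH P (same_seqS i) (A := set0)) // setU0 H_set0 subr0; apply.
- by move=> _; exact: pS_pmf.1.
- by move=> _; rewrite pS_pmf.2.
- by [].
- by move=> w /code_joint_gt0[_ /(_ i)[]].
Qed.

(** Causality of the feedback makes its kernel a function of the decoder's past view, as Gibbs'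
    inequality requires. *)
Lemma setH_crossK i : H ([set cK i] :|: decView i) - H (decView i) <= crossK i.
Proof.
rewrite -(condH_setH P (same_seqK i) (g := restr val (decView i))) //.
apply: condH_le_cross => //.
- by move=> w k; exact: (fb_pmf _ _ _ _ _ _ c _ _ _).1.
- by move=> w; rewrite (fb_pmf _ _ _ _ _ _ c _ _ _).2.
- move=> w w' /restr_eq e k; congr (_ k); apply: pK_causal => j ji; apply/eqP.
    by rewrite -val_atY e // !inE mem_pre ?orbT.
  by rewrite -val_atK e // !inE mem_pre ?orbT.
- by move=> w /code_joint_gt0[_ /(_ i)[]].
Qed.

Lemma setH_crossX i :
  H ([set cX i] :|: (encView i :|: [set cS i] :|: [set cK i]))
  - H (encView i :|: [set cS i] :|: [set cK i]) <= crossX i.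
Proof.
set A := _ :|: [set cK i].
rewrite -(condH_setH P (same_seqX i) (g := restr val A)) //.
apply: condH_le_cross => //.
- by move=> w k; exact: (enc_pmf _ _ _ _ _ _ c _ _ _ _ _).1.
- by move=> w; rewrite (enc_pmf _ _ _ _ _ _ c _ _ _ _ _).2.
- move=> w w' /restr_eq e x; congr (_ x); apply: pX_causal => [|j ji|j ji|j ji]; apply/eqP.
  + by rewrite -val_atM e // !inE eqxx.
  + by rewrite -val_atX e // !inE mem_pre ?orbT.
  + move: ji; rewrite leq_eqVlt => /predU1P[/val_inj ->|ji].
      by rewrite -val_atS e // !inE eqxx ?orbT.
    by rewrite -val_atS e // !inE mem_pre ?orbT.
  + move: ji; rewrite leq_eqVlt => /predU1P[/val_inj ->|ji].
      by rewrite -val_atK e // !inE eqxx ?orbT.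
    by rewrite -val_atK e // !inE mem_pre ?orbT.
- by move=> w /code_joint_gt0[_ /(_ i)[]].
Qed.

Lemma WZ_gt0 s x y z : 0 < W s x y z -> 0 < WZ s x z.
Proof.
move=> h; rewrite (lt_le_trans h) // /WZ (bigD1 y) //= lerDl.
by apply: sumr_ge0 => *; exact: W_ge0.
Qed.

Lemma WY_gt0 s x y z : 0 < W s x y z -> 0 < WY s x y.
Proof.
move=> h; rewrite (lt_le_trans h) // /WY (bigD1 z) //= lerDl.
by apply: sumr_ge0 => *; exact: W_ge0.
Qed.

Lemma setH_crossZ i : H ([set cZ i] :|: xs i) - H (xs i) <= crossZ i.
Proof.
rewrite -(condH_setH P (same_seqZ i) (g := restr val (xs i))) //.
apply: (condH_le_cross P_ge0 (k := fun w => WZ (seqS w i) (seqX w i))).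
- by move=> w z; apply: sumr_ge0 => *; exact: W_ge0.
- by move=> w; rewrite /WZ exchange_big /= sum_W.
- move=> w w' /restr_eq e z.
  have /eqP-> : seqS w i == seqS w' i by rewrite -val_atS e // !inE eqxx orbT.
  by have /eqP-> : seqX w i == seqX w' i by rewrite -val_atX e // !inE eqxx.
- by move=> w /code_joint_gt0[_ /(_ i)[_ _ _ /WZ_gt0]].
Qed.

(** Tested against [W / WY], the conditional law of [Z] given [Y], [X], [S]; the logarithm of the
    quotient splits into the two losses. *)
Lemma setH_crossZ_Y i :
  H ([set cZ i] :|: ([set cY i] :|: xs i)) - H ([set cY i] :|: xs i)
  <= crossYZ i - crossY i.
Proof.
set A := [set cY i] :|: _.
rewrite -(condH_setH P (same_seqZ i) (g := restr val A)) //.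
pose k (w : Om) z :=
  W (seqS w i) (seqX w i) (seqY w i) z / WY (seqS w i) (seqX w i) (seqY w i).
apply: le_trans (condH_le_cross P_ge0 (k := k) _ _ _ _) _.
- move=> w z; rewrite divr_ge0 ?W_ge0 //; apply: sumr_ge0 => *; exact: W_ge0.
- move=> w; rewrite /k -mulr_suml -/(WY _ _ _).
  have [->|?] := eqVneq (WY (seqS w i) (seqX w i) (seqY w i)) 0.
    by rewrite mul0r ler01.
  by rewrite mulfV.
- move=> w w' /restr_eq e z; rewrite /k.
  have /eqP-> : seqS w i == seqS w' i by rewrite -val_atS e // !inE eqxx !orbT.
  have /eqP-> : seqX w i == seqX w' i by rewrite -val_atX e // !inE eqxx !orbT.
  by have /eqP-> : seqY w i == seqY w' i by rewrite -val_atY e // !inE eqxx.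
- move=> w /code_joint_gt0[_ /(_ i)[_ _ _ h]].
  by rewrite divr_gt0 ?(WY_gt0 h).
rewrite /crossYZ /crossY -opprD lerN2 -sumrB; apply: ler_sum => w _.
have := P_ge0 w; rewrite le_eqVlt => /predU1P[<-|w_gt0]; first by rewrite !mul0r subr0.
have [_ /(_ i)[_ _ _ h]] := code_joint_gt0 w_gt0.
by rewrite /k log2M ?invr_gt0 ?(WY_gt0 h) // log2V ?(WY_gt0 h) // mulrBr.
Qed.

Lemma setH_cardK i A : H ([set cK i] :|: A) - H A <= log2 (kf i)%:R.
Proof.
rewrite -(condH_setH P (same_seqK i) (g := restr val A)) //.
apply: le_trans (condH_le_log_card P_ge0 _ _ P_sum1) _; by rewrite card_ord.
Qed.

Lemma pastE : past n n = decView n :|: (encView n :|: eveView n).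
Proof. by rewrite /past /decView /encView /eveView; set_eq. Qed.

Local Notation m := [set cM n].
Local Notation L := (@log2 R Mn%:R).

(** This is [log |K_i| + H(S_i|Z_i) + I(X_i;Y_i|Z_i,S_i)], the last term in the form
    [H(Y|Z,S) + H(Z|X,S) - H(Y,Z|X,S)] with log-losses for the entropies given [X] and [S]. *)
Definition secretGain i :=
  log2 (kf i)%:R + (H ([set cS i] :|: [set cZ i]) - H [set cZ i])
  + (H ([set cY i] :|: ([set cZ i] :|: [set cS i])) - H ([set cZ i] :|: [set cS i]))
  + crossZ i - crossYZ i.

(** The left side is the final potential [I(A_n;B_n|Z^n)]. A feedback symbol costs [log |K_i|] in
    the encoder's view and [crossK] in the decoder's; only the latter cancels against the joint
    entropy. *)
Lemma shared_secret_le : H m <= L ->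
  H (encView n :|: eveView n) + H (decView n :|: eveView n) - H (past n n)
  - H (eveView n) <= \sum_i secretGain i.
Proof.
move=> Hm.
have enc_le : H (encView n :|: eveView n) - H (encView 0 :|: eveView 0) <=
    \sum_i (crossS i + log2 (kf i)%:R + crossX i + crossZ i).
  apply: (@telescope_le R n (fun i => H (encView i :|: eveView i))) => i.
  have h := @step_encoder_view R _ H H_submod m (pre (@cX n) i) (pre (@cS n) i)
    (pre (@cK n) i) (pre (@cZ n) i) [set cX i] [set cS i] [set cK i] [set cZ i]
    H_set0 (log2 (kf i)%:R) (setH_cardK i).
  have hS := setH_crossS i; have hX := setH_crossX i; have hZ := setH_crossZ i.
  rewrite /encView /eveView !preS in h hX *; lra.
have dec_le : H (decView n :|: eveView n) - H (eveView n)
      - (H (decView 0 :|: eveView 0) - H (eveView 0)) <=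
    \sum_i (H ([set cS i] :|: [set cZ i]) - H [set cZ i] + crossK i
    + (H ([set cY i] :|: ([set cZ i] :|: [set cS i])) - H ([set cZ i] :|: [set cS i]))).
  apply: (@telescope_le R n (fun i => H (decView i :|: eveView i) - H (eveView i))) => i.
  have h := @step_decoder_view R _ H H_submod (pre (@cS n) i) (pre (@cK n) i)
    (pre (@cY n) i) (pre (@cZ n) i) [set cS i] [set cK i] [set cY i] [set cZ i].
  have hK := setH_crossK i; rewrite /decView /eveView !preS in h hK *; lra.
rewrite {2}/encView {2}/eveView !pre0 !setU0 in enc_le.
rewrite {2}/decView !{2}/eveView !pre0 !setU0 subrr subr0 in dec_le.
rewrite setH_past.
have -> : \sum_i secretGain i =
  \sum_i (crossS i + log2 (kf i)%:R + crossX i + crossZ i)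
  + \sum_i (H ([set cS i] :|: [set cZ i]) - H [set cZ i] + crossK i
    + (H ([set cY i] :|: ([set cZ i] :|: [set cS i])) - H ([set cZ i] :|: [set cS i])))
  - \sum_i (crossS i + crossK i + crossX i + crossYZ i).
  by rewrite -big_split -sumrB; apply: eq_bigr => i _ /=; rewrite /secretGain; lra.
lra.
Qed.

(** [h2] is data processing, [I(M;B|Z) <= I(A;B|Z)], since the message belongs to the encoder's
    view; [h1] drops the eavesdropper's outputs from the conditioning. *)
Lemma secrecy_bound : H m <= L ->
  H (m :|: eveView n) - H (eveView n)
  <= H (m :|: decView n) - H (decView n) + \sum_i secretGain i.
Proof.
move=> /shared_secret_le h.
have h1 : H (m :|: (decView n :|: eveView n)) - H (decView n :|: eveView n) <=
  H (m :|: decView n) - H (decView n) by apply: H_submod; set_sub.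
have h2 : H (decView n :|: (encView n :|: eveView n)) - H (encView n :|: eveView n) <=
  H (decView n :|: (m :|: eveView n)) - H (m :|: eveView n).
  by apply: H_submod; rewrite /encView; set_sub.
rewrite -pastE in h2.
have e : decView n :|: (m :|: eveView n) = m :|: (decView n :|: eveView n) by set_eq.
rewrite e in h2; lra.
Qed.

(** Splits the exact joint entropy into the decoder's view, the message given it, and the inputs and
    eavesdropper outputs given both; every loss except [crossY] cancels. *)
Lemma reliability_bound :
  L <= H (m :|: decView n) - H (decView n)
    + \sum_i (H ([set cY i] :|: [set cS i]) - H [set cS i] - crossY i).
Proof.
have dec_le : H (decView n) - H (decView 0) <=
    \sum_i (crossS i + crossK i + (H ([set cY i] :|: [set cS i]) - H [set cS i])).
  apply: (@telescope_le R n (fun i => H (decView i))) => i.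
  have h := @step_decoder_alone R _ H H_submod (pre (@cS n) i)
    (pre (@cK n) i) (pre (@cY n) i) [set cS i] [set cK i] [set cY i] H_set0.
  have := setH_crossS i; have := setH_crossK i.
  rewrite /decView !preS in h *; lra.
pose B := m :|: decView n.
have rest_le : H (B :|: pre (@cX n) n :|: pre (@cZ n) n)
    - H (B :|: pre (@cX n) 0 :|: pre (@cZ n) 0) <=
    \sum_i (crossX i + (crossYZ i - crossY i)).
  apply: (@telescope_le R n (fun i => H (B :|: pre (@cX n) i :|: pre (@cZ n) i))) => i.
  have pre_sub (f : 'I_n -> coordinate n) : [set f i] :|: pre f i \subset pre f n.
    rewrite -preS; apply/subsetP => _ /imsetP[j _ ->]; exact: mem_pre.
  have h := @step_rest R _ H H_submod m (pre (@cX n) i) (pre (@cS n) i)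
    (pre (@cK n) i) (pre (@cZ n) i) [set cX i] [set cS i] [set cK i] [set cY i] [set cZ i] B.
  have h1 := setH_crossX i; have h2 := setH_crossZ_Y i.
  rewrite !preS; apply: le_trans (h _ _ _ _) _.
  - by rewrite subsetUl.
  - by apply: subset_trans (pre_sub (@cS n)) _; rewrite /B /decView; set_sub.
  - by apply: subset_trans (pre_sub (@cK n)) _; rewrite /B /decView; set_sub.
  - apply: subset_trans (subset_trans (subsetUl _ _) (pre_sub (@cY n))) _.
    by rewrite /B /decView; set_sub.
  rewrite /encView in h1; lra.
have BE : B :|: pre (@cX n) n :|: pre (@cZ n) n = past n n.
  by rewrite /B /decView /past; set_eq.
rewrite BE setH_past !pre0 !setU0 /B in rest_le.
rewrite {2}/decView !pre0 !setU0 H_set0 subr0 in dec_le.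
have -> : \sum_i (H ([set cY i] :|: [set cS i]) - H [set cS i] - crossY i) =
  \sum_i (crossS i + crossK i + (H ([set cY i] :|: [set cS i]) - H [set cS i]))
  + \sum_i (crossX i + (crossYZ i - crossY i))
  - \sum_i (crossS i + crossK i + crossX i + crossYZ i).
  by rewrite -big_split -sumrB; apply: eq_bigr => i _ /=; lra.
lra.
Qed.

End Converse.

(** * The single-letter law and its information quantities *)

Section SingleLetter.
Variables (R : realType) (X Y Z S : finType).
Variables (pS : S -> R) (W : S -> X -> Y -> Z -> R) (q : S -> X -> R).
Hypotheses (pS_pmf : is_pmf pS) (W_pmf : valid_channel W).
Hypothesis q_pmf : forall s, is_pmf (q s).

Local Notation J := (joint1 pS q W).
Local Notation U := (S * X * Y * Z)%type.
Local Notation rvS := (@rvS X Y Z S).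
Local Notation rvX := (@rvX X Y Z S).
Local Notation rvY := (@rvY X Y Z S).
Local Notation rvZ := (@rvZ X Y Z S).
Local Notation rvXS := (fun u : U => (rvX u, rvS u)).

Lemma joint1_ge0 u : 0 <= J u.
Proof.
case: u => [[[s x] y] z] /=; rewrite !mulr_ge0 //; first exact: pS_pmf.1.
  exact: (q_pmf s).1.
exact: W_ge0.
Qed.

Lemma marg_joint1_XS x s : marg J rvXS (x, s) = pS s * q s x.
Proof.
rewrite /marg (reindex_onto (fun yz : Y * Z => (s, x, yz.1, yz.2))
                            (fun u => (rvY u, rvZ u))) /=; last first.
  by move=> [[[s' x'] y] z] /= /eqP[-> ->].
rewrite (eq_bigl xpredT) => [|[y z]]; last by rewrite /= !eqxx.
by rewrite -mulr_sumr (W_pmf s x).2 mulr1.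
Qed.

(** The channel kernel is the exact conditional law, which makes this entropy linear in the input
    law. *)
Lemma condH_joint1_Z : condH J rvZ rvXS =
  - \sum_u J u * log2 (WZ W (rvS u) (rvX u) (rvZ u)).
Proof.
apply: condH_kernel => [|[[[s x] y] z] /=]; first exact: joint1_ge0.
rewrite marg_joint1_XS /marg (reindex_onto (fun y => (s, x, y, z)) rvY) /=; last first.
  by move=> [[[s' x'] y'] z'] /= /eqP[-> -> ->].
rewrite (eq_bigl xpredT) => [|y']; last by rewrite /= !eqxx.
by rewrite -mulr_sumr.
Qed.

Lemma condH_joint1_Y : condH J rvY rvXS =
  - \sum_u J u * log2 (WY W (rvS u) (rvX u) (rvY u)).
Proof.
apply: condH_kernel => [|[[[s x] y] z] /=]; first exact: joint1_ge0.
rewrite marg_joint1_XS /marg (reindex_onto (fun z => (s, x, y, z)) rvZ) /=; last first.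
  by move=> [[[s' x'] y'] z'] /= /eqP[-> -> ->].
rewrite (eq_bigl xpredT) => [|z']; last by rewrite /= !eqxx.
by rewrite -mulr_sumr.
Qed.

Lemma condH_joint1_YZ : condH J (fun u => (rvY u, rvZ u)) rvXS =
  - \sum_u J u * log2 (W (rvS u) (rvX u) (rvY u) (rvZ u)).
Proof.
apply: condH_kernel => [|[[[s x] y] z] /=]; first exact: joint1_ge0.
rewrite marg_joint1_XS /marg (big_pred1 (s, x, y, z)) // => -[[[s' x'] y'] z'] /=.
by rewrite !xpair_eqE; do ! case: (_ == _).
Qed.

(** Symmetry of mutual information and the chain rule, in the shape used by [secretGain]. *)
Lemma cmi_joint1_YZS : cmi J rvX rvY (fun u => (rvZ u, rvS u)) =
  condH J rvY (fun u => (rvZ u, rvS u)) + condH J rvZ rvXS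
  - condH J (fun u => (rvY u, rvZ u)) rvXS.
Proof.
rewrite /cmi /condH.
have -> : Hrv J (fun w => (rvX w, (rvZ w, rvS w))) = Hrv J (fun w => (rvZ w, (rvX w, rvS w))).
  by apply: Hrv_ker => u u'; rewrite !xpair_eqE andbCA.
have -> : Hrv J (fun w => (rvX w, (rvY w, (rvZ w, rvS w)))) =
          Hrv J (fun w => (rvY w, rvZ w, (rvX w, rvS w))).
  by apply: Hrv_ker => u u'; rewrite !xpair_eqE; do ! case: (_ == _).
lra.
Qed.

Lemma cmi_joint1_YS : cmi J rvX rvY rvS = condH J rvY rvS - condH J rvY rvXS.
Proof.
rewrite /cmi /condH.
have -> : Hrv J (fun w => (rvX w, (rvY w, rvS w))) = Hrv J (fun w => (rvY w, (rvX w, rvS w))).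
  by apply: Hrv_ker => u u'; rewrite !xpair_eqE andbCA.
lra.
Qed.

End SingleLetter.

(** * Single-letter bounds at the average input law, and Fano's inequality *)

Section CodeBound.
Variables (R : realType) (X Y Z S : finType) (n Mn : nat).
Variable c : code R X Y S n Mn.
Variables (pS : S -> R) (W : S -> X -> Y -> Z -> R).
Hypotheses (pS_pmf : is_pmf pS) (W_pmf : valid_channel W).
Hypothesis n_gt0 : (0 < n)%N.

Local Notation kf := (kf R X Y S n Mn c).
Local Notation Om := (omega Z c).
Variable w0 : Om.
Local Notation P := (@code_joint R X Y Z S n Mn pS W c).
Local Notation val := (@val_at R X Y Z S n Mn c).
Local Notation same A w w' := (restr val A w' == restr val A w).
Local Notation H := (setH P val).
Local Notation letter4 := (@letter4 R X Y Z S n Mn c).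
Local Notation rvS := (@rvS X Y Z S).
Local Notation rvX := (@rvX X Y Z S).
Local Notation rvY := (@rvY X Y Z S).
Local Notation rvZ := (@rvZ X Y Z S).
Local Notation m := [set cM n].
Local Notation L := (@log2 R Mn%:R).

Let P_ge0 w : 0 <= P w. Proof. exact: code_joint_ge0. Qed.
Let P_sum1 : \sum_w P w = 1. Proof. exact: code_joint_sum1 w0. Qed.

(** Every [S_i] has law [pS], so averaging the conditional input laws averages the joint letter laws
    ([sum_letter4]). *)
Definition avg_input (s : S) (x : X) : R :=
  n%:R^-1 * \sum_(i < n) letter_input c pS W i s x.

Local Notation J := (joint1 pS avg_input W).

Lemma avg_input_pmf s : is_pmf (avg_input s).
Proof.
have nz : 0 < n%:R :> R by rewrite ltr0n.
split=> [x|].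
  rewrite mulr_ge0 ?invr_ge0 ?ler0n // sumr_ge0 // => i _.
  exact: (letter_input_pmf pS_pmf W_pmf w0 i s).1.
rewrite -mulr_sumr exchange_big /= (eq_bigr (fun=> 1)) => [|i _].
  by rewrite sumr_const card_ord mulVf ?gt_eqF.
exact: (letter_input_pmf pS_pmf W_pmf w0 i s).2.
Qed.

Lemma sum_letter4 (phi : S * X * Y * Z -> R) :
  \sum_(i < n) \sum_w P w * phi (letter4 i w) = n%:R * \sum_u J u * phi u.
Proof.
have nz : n%:R != 0 :> R by rewrite pnatr_eq0 -lt0n.
under eq_bigr do rewrite (expect_letter4 c pS_pmf W_pmf).
rewrite exchange_big mulr_sumr /=; apply: eq_bigr => -[[[s x] y] z] _.
rewrite -mulr_suml mulrA; congr (_ * _); rewrite /= /avg_input.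
rewrite -mulr_suml -mulr_sumr; field; exact: nz.
Qed.

(** Each letter law is absolutely continuous with respect to the average law, the positivity that
    Gibbs' inequality asks for; proved by testing [sum_letter4] on an indicator. *)
Lemma joint1_letter4_gt0 i w : 0 < P w -> 0 < J (letter4 i w).
Proof.
move=> w_gt0.
have := sum_letter4 (fun u => (u == letter4 i w)%:R).
rewrite [in RHS](bigD1 (letter4 i w)) //= eqxx mulr1.
rewrite [in RHS]big1 => [|u /negbTE->]; last by rewrite mulr0.
rewrite addr0 => e.
suff : 0 < n%:R * J (letter4 i w) by rewrite pmulr_rgt0 ?ltr0n.
rewrite -e (bigD1 i) //= (bigD1 w) //= eqxx mulr1.
rewrite -addrA ltr_pwDl // addr_ge0 //.
  by apply: sumr_ge0 => *; rewrite mulr_ge0 // ler0n.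
by apply: sumr_ge0 => *; apply: sumr_ge0 => *; rewrite mulr_ge0 // ler0n.
Qed.

(* Concavity of the conditional entropy in the law: each letter law is tested
   against the conditional law of the average [J], for which the cross entropy
   is linear. *)
Lemma sum_condH_letter4 (B D : finType) (f : S * X * Y * Z -> B) (g : S * X * Y * Z -> D) :
  \sum_(i < n) condH P (fun w => f (letter4 i w)) (fun w => g (letter4 i w))
  <= n%:R * condH J f g.
Proof.
have J_ge0 u : 0 <= J u by apply: joint1_ge0 => // s; exact: avg_input_pmf.
pose h u := (f u, g u).
pose k (u : S * X * Y * Z) b := marg J h (b, g u) / marg J g (g u).
apply: (@le_trans _ _ (\sum_(i < n) - \sum_w P w * log2 (k (letter4 i w) (f (letter4 i w))))).
  apply: ler_sum => i _; apply: (condH_le_cross P_ge0 (k := fun w => k (letter4 i w))).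
  - by move=> w b; rewrite divr_ge0 ?marg_ge0.
  - by move=> w; exact: sum_cond_law_le1.
  - by move=> w w' e b; rewrite /k e.
  - move=> w /(joint1_letter4_gt0 i) u_gt0.
    by rewrite divr_gt0 ?(marg_gt0 J_ge0 g) ?(marg_gt0 J_ge0 h).
rewrite sumrN (sum_letter4 (fun u => log2 (k u (f u)))) -mulrN ler_wpM2l ?ler0n //.
rewrite condHE lerN2; apply: ler_sum => u _.
have := J_ge0 u; rewrite le_eqVlt => /predU1P[<-|u_gt0]; first by rewrite !mul0r.
have g_gt0 := marg_gt0 J_ge0 g u_gt0; have h_gt0 := marg_gt0 J_ge0 h u_gt0.
by rewrite /k log2M ?invr_gt0 // log2V.
Qed.

(** The entropies of [S] given [Z] and of [Y] given [Z], [S] have a plus sign and are bounded by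
    concavity; the log-losses are linear in the law and average exactly. *)
Lemma sum_secretGain :
  \sum_i secretGain c pS W i <= \sum_(i < n) log2 (kf i)%:R +
  n%:R * (cmi J rvX rvY (fun u => (rvZ u, rvS u)) + condH J rvS rvZ).
Proof.
rewrite cmi_joint1_YZS.
pose hSZ i := condH P (fun w => rvS (letter4 i w)) (fun w => rvZ (letter4 i w)).
pose hYZS i := condH P (fun w => rvY (letter4 i w))
  (fun w => (rvZ (letter4 i w), rvS (letter4 i w))).
have hS : \sum_i hSZ i <= _ := sum_condH_letter4 rvS rvZ.
have hY : \sum_i hYZS i <= _ := sum_condH_letter4 rvY (fun u => (rvZ u, rvS u)).
have eZ : \sum_i crossZ c pS W i = n%:R * condH J rvZ (fun u => (rvX u, rvS u)).
  rewrite condH_joint1_Z //; last exact: avg_input_pmf.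
  by rewrite mulrN -sum_letter4 -sumrN.
have eYZ : \sum_i crossYZ c pS W i =
    n%:R * condH J (fun u => (rvY u, rvZ u)) (fun u => (rvX u, rvS u)).
  rewrite condH_joint1_YZ //; last exact: avg_input_pmf.
  by rewrite mulrN -sum_letter4 -sumrN.
have condS i : H ([set cS i] :|: [set cZ i]) - H [set cZ i] = hSZ i.
  by rewrite -(condH_setH P (same_seqS (c := c) i) (same_seqZ (c := c) i)).
have condY i : H ([set cY i] :|: ([set cZ i] :|: [set cS i]))
    - H ([set cZ i] :|: [set cS i]) = hYZS i.
  rewrite /hYZS (condH_setH P (same_seqY (c := c) i) (A := [set cZ i] :|: [set cS i])) //.
  by move=> w w'; rewrite xpair_eqE restrU -same_seqS -same_seqZ.
rewrite [leLHS](eq_bigr (fun i => log2 (kf i)%:R + hSZ i + hYZS i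
  + crossZ c pS W i - crossYZ c pS W i)); last first.
  by move=> i _; rewrite /secretGain condS condY.
clearbody hSZ hYZS; rewrite sumrB !big_split /= eZ eYZ; move: hS hY.
set t1 := condH J rvS rvZ; set t2 := condH J rvY _; set t3 := condH J rvZ _.
set t4 := condH J (fun u => (rvY u, _)) _; lra.
Qed.

Lemma sum_reliability :
  \sum_i (H ([set cY i] :|: [set cS i]) - H [set cS i] - crossY c pS W i)
  <= n%:R * cmi J rvX rvY rvS.
Proof.
rewrite cmi_joint1_YS.
have hY := sum_condH_letter4 rvY rvS.
have eY : \sum_i crossY c pS W i = n%:R * condH J rvY (fun u => (rvX u, rvS u)).
  rewrite condH_joint1_Y //; last exact: avg_input_pmf.
  by rewrite mulrN -sum_letter4 -sumrN.
rewrite [leLHS](eq_bigr (fun i =>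
  condH P (fun w => rvY (letter4 i w)) (fun w => rvS (letter4 i w)) - crossY c pS W i)).
  by rewrite sumrB eY; lra.
by move=> i _; rewrite -(condH_setH P (same_seqY (c := c) i) (same_seqS (c := c) i)).
Qed.

Definition fano_slack (eps : R) : R := - log2 (1 - eps) - eps * log2 eps.

Lemma same_seqM w w' : (seqM w' == seqM w) = same m w w'.
Proof. by rewrite same1 val_atE. Qed.

(** Gibbs' inequality with a mixture of the point mass at the decoder's guess and the uniform law: a
    correct guess costs at most [- log2 (1 - eps)], an error costs [L - log2 eps]. *)
Lemma fano eps : 0 < eps -> eps < 1 -> err_prob pS W c <= eps ->
  H (m :|: decView n n) - H (decView n n) <= fano_slack eps + eps * L.
Proof.
move=> e0 e1 err.
have M_gt0 : (0 < Mn)%N by exact: leq_ltn_trans (ltn_ord (seqM w0)).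
have Mr_gt0 : 0 < Mn%:R :> R by rewrite ltr0n.
pose guess (w : Om) := dec R X Y S n Mn c (seqY w) (seqS w) (seqK w).
pose k (w : Om) (x : 'I_Mn) : R := (x == guess w)%:R * (1 - eps) + eps / Mn%:R.
have eM : 0 < eps / Mn%:R by rewrite divr_gt0.
rewrite -(condH_setH P same_seqM (g := restr val (decView n n))) //.
apply: le_trans (condH_le_cross P_ge0 (k := k) _ _ _ _) _.
- by move=> w x; rewrite addr_ge0 ?(ltW eM) // mulr_ge0 ?ler0n //; lra.
- move=> w; rewrite big_split /= -mulr_suml sumr_const card_ord.
  rewrite (bigD1 (guess w)) //= eqxx big1 => [|x /negbTE-> //].
  by rewrite addr0 mul1r -[X in _ + X]mulr_natr divfK ?gt_eqF // subrK.
- move=> w w' /restr_eq e x; rewrite /k; suff -> : guess w = guess w' by [].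
  rewrite /guess; congr (dec _ _ _ _ _ _ _ _ _ _); apply/ffunP => j; apply/eqP.
  + by rewrite -val_atY e // !inE mem_pre ?orbT.
  + by rewrite -val_atS e // !inE mem_pre ?orbT.
  + by rewrite -val_atK e // !inE mem_pre ?orbT.
- by move=> w _; rewrite ltr_wpDl // mulr_ge0 ?ler0n //; lra.
have lM : 0 <= L by have := @ler_log2 R 1 Mn%:R ltr01; rewrite log21 ler1n; apply.
have le0 := log2_le0 (ltW e1).
have l1e : log2 (1 - eps) <= 0 by apply: log2_le0; lra.
have errE : err_prob pS W c = \sum_w P w * (seqM w != guess w)%:R.
  rewrite /err_prob big_mkcond; apply: eq_bigr => -[[[[[x s] kk] xx] y] z] _.
  by rewrite eq_sym /guess /seqM /=; case: ifP => _; rewrite ?mulr1 ?mulr0.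
apply: (@le_trans _ _ (\sum_w (P w * - log2 (1 - eps)
    + P w * (seqM w != guess w)%:R * (L - log2 eps)))).
  rewrite -sumrN; apply: ler_sum => w _; rewrite -mulrA -mulrDr -mulrN ler_wpM2l //.
  rewrite /k; case: eqP => _ /=.
    rewrite mul1r mul0r addr0 lerN2 ler_log2 //; lra.
  by rewrite mul0r add0r mul1r log2M ?invr_gt0 // log2V //; lra.
rewrite big_split /= -!mulr_suml P_sum1 mul1r -errE /fano_slack.
have : err_prob pS W c * (L - log2 eps) <= eps * (L - log2 eps).
  by rewrite ler_wpM2r //; lra.
lra.
Qed.

Lemma condH_message_eavesdropper :
  condH P (@rvM R X Y Z S n Mn c) (@rvZn R X Y Z S n Mn c) =
  H (m :|: eveView n n) - H (eveView n n).
Proof.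
apply: condH_setH => w w'.
  by rewrite !rvME same_seqM.
have rvZnE (v : Om) : rvZn v = seqZ v by case: v => [[[[[? ?] ?] ?] ?] ?].
rewrite !rvZnE; apply/eqP/same_preP => [e j _|e]; first by rewrite val_atZ e.
by apply/ffunP => j; apply/eqP; rewrite -val_atZ e.
Qed.

Lemma setH_message : H m = L.
Proof.
rewrite -(Hrv_message pS_pmf W_pmf w0); apply: Hrv_ker => w w'.
by rewrite !rvME same_seqM.
Qed.

Lemma code_secrecy_bound eps : 0 < eps -> eps < 1 -> err_prob pS W c <= eps ->
  condH P (@rvM R X Y Z S n Mn c) (@rvZn R X Y Z S n Mn c) <=
  fano_slack eps + eps * L + \sum_(i < n) log2 (kf i)%:R +
  n%:R * (cmi J rvX rvY (fun u => (rvZ u, rvS u)) + condH J rvS rvZ).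
Proof.
move=> e0 e1 err; rewrite condH_message_eavesdropper.
have h1 := fano e0 e1 err; have h2 := sum_secretGain.
have := secrecy_bound pS_pmf W_pmf w0; rewrite setH_message => /(_ (lexx _)); lra.
Qed.

Lemma code_reliability_bound eps : 0 < eps -> eps < 1 -> err_prob pS W c <= eps ->
  L <= fano_slack eps + eps * L + n%:R * cmi J rvX rvY rvS.
Proof.
move=> e0 e1 err.
have h1 := fano e0 e1 err; have h2 := sum_reliability.
have := reliability_bound pS_pmf W_pmf w0; lra.
Qed.

End CodeBound.

(** * Continuity of the bound and compactness of the set of input laws *)

Section Continuity.
Local Open Scope classical_set_scope.
Variable R : realType.

(** With [x = r * r], apply [log2 y <= (y - 1) / ln 2] to [y = r^-1]. For [x <= 0] the left side is
    0 because [ln] is. This modulus serves continuity at 0. *)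
Lemma norm_xlog2x_le (x : R) : x < 1 -> `|x * log2 x| <= 2 / ln 2 * Num.sqrt x.
Proof.
move=> x1; have [x0|x0] := leP x 0.
  by rewrite /log2 ln0 // mul0r mulr0 normr0 mulr_ge0 ?divr_ge0 ?sqrtr_ge0 ?ltW ?ln2_gt0.
have r_gt0 : 0 < Num.sqrt x by rewrite sqrtr_gt0.
have xE : x = Num.sqrt x * Num.sqrt x by rewrite -expr2 sqr_sqrtr ?ltW.
move: r_gt0 xE x1; set r := Num.sqrt x => r_gt0 -> x1.
have r1 : r < 1 by rewrite -(@ltr_pXn2r _ 2) ?nnegrE ?ler01 ?ltW // expr1n expr2.
have lr : log2 r <= 0 by rewrite log2_le0 ?ltW.
rewrite log2M // ler0_norm; last by rewrite mulr_ge0_le0 ?(ltW (mulr_gt0 _ _)) //; lra.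
have : - log2 r <= r^-1 / ln 2.
  rewrite -log2V // (le_trans (log2_le_sub1 _)) ?invr_gt0 // ler_pM2r ?invr_gt0 ?ln2_gt0 //.
  lra.
move=> h; have -> : - (r * r * (log2 r + log2 r)) = 2 * (r * (r * - log2 r)) by ring.
rewrite [X in _ <= X](_ : _ = 2 * (r * (ln 2)^-1)); last by ring.
rewrite ler_pM2l // ler_pM2l //.
have := ler_wpM2l (ltW r_gt0) h; rewrite mulrA mulfV ?gt_eqF // mul1r; apply.
Qed.

Lemma continuous_xlog2x : continuous (fun x : R => x * log2 x).
Proof.
move=> x; have [x0|x0] := ltP 0 x.
  apply: cvgM; first exact: cvg_id.
  by apply: cvgM; [exact: continuous_ln|exact: cvg_cst].
rewrite /continuous_at [X in _ --> X](_ : _ = 0); last by rewrite /log2 ln0 // mul0r mulr0.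
pose b (y : R) := 2 / ln 2 * Num.sqrt y.
have b_cvg : b y @[y --> x] --> (0 : R).
  rewrite [X in _ --> X](_ : _ = 2 / ln 2 * Num.sqrt x); last first.
    by rewrite ler0_sqrtr // mulr0.
  by apply: cvgM; [exact: cvg_cst|exact: sqrt_continuous].
apply: (@squeeze_cvgr _ _ _ _ (fun y => - b y) b) => //.
  near=> y; rewrite -ler_norml; apply: norm_xlog2x_le.
  near: y; apply: (@lt_nbhsl _ _ 1); lra.
by rewrite -[X in _ --> X]oppr0; exact: cvgN.
Unshelve. all: by end_near. Qed.

Lemma continuous_sumr (T : topologicalType) (I : finType) (Q : pred I) (F : I -> T -> R) :
  (forall i, Q i -> continuous (F i)) -> continuous (fun x => \sum_(i | Q i) F i x).
Proof. by move=> Fc; apply: continuous_big => //; exact: add_continuous. Qed.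

Lemma continuous_addr (T : topologicalType) (f g : T -> R) :
  continuous f -> continuous g -> continuous (fun x => f x + g x).
Proof. by move=> fc gc x; apply: cvgD; [exact: fc|exact: gc]. Qed.

Lemma continuous_subr (T : topologicalType) (f g : T -> R) :
  continuous f -> continuous g -> continuous (fun x => f x - g x).
Proof. by move=> fc gc x; apply: cvgB; [exact: fc|exact: gc]. Qed.

Lemma continuous_oppr (T : topologicalType) (f : T -> R) :
  continuous f -> continuous (fun x => - f x).
Proof. by move=> fc x; apply: cvgN; exact: fc. Qed.

Lemma continuous_mull (T : topologicalType) (a : R) (f : T -> R) :
  continuous f -> continuous (fun x => a * f x).
Proof. by move=> fc x; apply: cvgMl_tmp; exact: fc. Qed.

Lemma continuous_minr (T : topologicalType) (f g : T -> R) :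
  continuous f -> continuous g -> continuous (fun x => Num.min (f x) (g x)).
Proof. by move=> fc gc x; apply: (@continuous_min R T f g); [exact: fc|exact: gc]. Qed.

Variables (X Y Z S : finType) (pS : S -> R) (W : S -> X -> Y -> Z -> R).

(** Kernels are uncurried to form a product space, where Tychonoff's theorem applies. *)
Local Notation kernels := (prod_topology (fun _ : S * X => R)).
Let q_of (g : kernels) (s : S) (x : X) : R := g (s, x).

Lemma continuous_eval (p : S * X) : continuous (fun g : kernels => g p).
Proof. exact: (@proj_continuous _ (fun _ : S * X => R) p). Qed.

Lemma continuous_Hrv (B : finType) (f : S * X * Y * Z -> B) :
  continuous (fun g : kernels => Hrv (joint1 pS (q_of g) W) f).
Proof.
have margC b : continuous (fun g : kernels => marg (joint1 pS (q_of g) W) f b).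
  apply: continuous_sumr => -[[[s x] y] z] _.
  rewrite (_ : (fun g => _) = fun g : kernels => pS s * W s x y z * g (s, x)).
    exact/continuous_mull/continuous_eval.
  by apply/funext => g /=; rewrite mulrAC.
apply/continuous_oppr/continuous_sumr => b _ g.
exact: (continuous_comp (margC b g) (@continuous_xlog2x _)).
Qed.

Lemma continuous_condH (B C : finType) (f : S * X * Y * Z -> B) (h : S * X * Y * Z -> C) :
  continuous (fun g : kernels => condH (joint1 pS (q_of g) W) f h).
Proof. by apply: continuous_subr; exact: continuous_Hrv. Qed.

Lemma continuous_cmi (B C D : finType) (f : S * X * Y * Z -> B)
    (h : S * X * Y * Z -> C) (k : S * X * Y * Z -> D) :
  continuous (fun g : kernels => cmi (joint1 pS (q_of g) W) f h k).
Proof. by apply: continuous_subr; exact: continuous_condH. Qed.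

Lemma continuous_upper_bound_expr Rf :
  continuous (fun g : kernels => upper_bound_expr pS W Rf (q_of g)).
Proof.
apply: continuous_minr; last exact: continuous_cmi.
pose a (g : kernels) := cmi (joint1 pS (q_of g) W) (@rvX X Y Z S) (@rvY X Y Z S)
  (fun w => (rvZ w, rvS w)) + condH (joint1 pS (q_of g) W) (@rvS X Y Z S) (@rvZ X Y Z S).
apply: (@continuous_addr _ a (fun=> Rf)); last exact: cst_continuous.
by apply: continuous_addr; [exact: continuous_cmi|exact: continuous_condH].
Qed.

(** The laws form a closed part of the cube of functions with values in [[0, 1]]. *)
Lemma compact_kernels : compact [set g : kernels | forall s, is_pmf (q_of g s)].
Proof.
apply: (@subclosed_compact _ _ [set g : kernels | forall p, `[0, 1]%classic (g p)]).
- rewrite (_ : [set g : kernels | _] = \bigcap_(p in [set: S * X]) [set g : kernels | 0 <= g p]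
    `&` \bigcap_(s in [set: S]) [set g : kernels | \sum_x g (s, x) = 1]).
    apply: closedI; apply: closed_bigI => p _.
      apply: (@preimage_closed _ _ (fun g : kernels => g p) [set x | 0 <= x]).
        by move=> g _; exact: continuous_eval.
      exact: closed_ge.
    apply: (@preimage_closed _ _ (fun g : kernels => \sum_x g (p, x)) [set x | x = 1]).
      by move=> g _; apply: continuous_sumr => x _; exact: continuous_eval.
    exact: closed_eq.
  apply/seteqP; split=> [g gP|g [g0 g1] s].
    split=> [[s x] _|s _]; first exact: (gP s).1.
    exact: (gP s).2.
  by split=> [x|]; [exact: g0 (s, x) I|exact: g1 s I].
- apply: (@tychonoff _ (fun _ : S * X => R) (fun _ => `[0, 1]%classic)) => _.
  exact: segment_compact.
- move=> g gP [s x]; have [g0 g1] := gP s; rewrite /= in_itv /=; apply/andP; split.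
    exact: g0.
  by rewrite -g1 (bigD1 x) //= lerDl; apply: sumr_ge0 => *; exact: g0.
Qed.

(** Extreme value theorem; [q0] witnesses that the compact set is nonempty. *)
Lemma upper_bound_expr_max Rf (q0 : S -> X -> R) : (forall s, is_pmf (q0 s)) ->
  exists q, (forall s, is_pmf (q s)) /\
    forall q', (forall s, is_pmf (q' s)) ->
      upper_bound_expr pS W Rf q' <= upper_bound_expr pS W Rf q.
Proof.
move=> q0P.
have [||g /set_mem gP gmax] := @compact_EVT_max _ R
  (fun g : kernels => upper_bound_expr pS W Rf (q_of g)) _ _ compact_kernels.
- by exists (fun p => q0 p.1 p.2).
- exact/continuous_subspaceT/continuous_upper_bound_expr.
exists (q_of g); split=> // q' q'P.
by apply: (gmax (fun p => q' p.1 p.2)); apply/mem_set.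
Qed.

End Continuity.

(** * Rate bound with slack, and its limit *)

Lemma log2_msg_size (R : realType) n (Rt : R) : n%:R * Rt <= log2 (msg_size n Rt)%:R.
Proof.
have p_gt0 : 0 < powR 2 (n%:R * Rt) :> R by apply: powR_gt0; lra.
have : powR 2 (n%:R * Rt) <= (msg_size n Rt)%:R.
  by rewrite /msg_size natr_absz gtr0_norm ?ceil_gt0 // ceil_ge.
move/(ler_log2 p_gt0); apply: le_trans.
by rewrite /log2 ln_powR mulfK // gt_eqF // ln2_gt0.
Qed.

Lemma fano_slack_ge0 (R : realType) (eps : R) : 0 < eps -> eps < 1 -> 0 <= fano_slack eps.
Proof.
move=> e0 e1; rewrite /fano_slack.
have : log2 (1 - eps) <= 0 by apply: log2_le0; lra.
have : eps * log2 eps <= 0 by rewrite pmulr_rle0 //; apply: log2_le0; lra.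
lra.
Qed.

(** Squaring the parameter removes the logarithmic singularity: [eta * log2 eta^-1] is bounded, so
    the slack at [eta ^+ 2] is at most linear in [eta]. *)
Lemma fano_slack_sqr (R : realType) (eta : R) : 0 < eta -> eta <= 2^-1 ->
  fano_slack (eta ^+ 2) <= 4 / ln 2 * eta.
Proof.
move=> e0 e1; rewrite /fano_slack expr2.
have l2 := @ln2_gt0 R; have v2 : 0 < (ln 2 : R)^-1 by rewrite invr_gt0.
have ee : eta * eta <= 2^-1 * eta by rewrite ler_pM2r.
have h1 : - log2 (1 - eta * eta) <= 2 * (eta * eta) / ln 2.
  have p_gt0 : 0 < 1 - eta * eta by lra.
  rewrite -log2V // (le_trans (log2_le_sub1 _)) ?invr_gt0 // ler_pM2r // lerBlDr.
  rewrite -div1r ler_pdivrMr //; nra.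
have h2 : - (eta * log2 eta) <= (ln 2)^-1.
  rewrite -mulrN -log2V //.
  have : log2 eta^-1 <= eta^-1 / ln 2.
    rewrite (le_trans (log2_le_sub1 _)) ?invr_gt0 // ler_pM2r //; lra.
  by move/(ler_wpM2l (ltW e0)); rewrite (mulrA eta eta^-1) mulfV ?gt_eqF // mul1r.
rewrite log2M //.
have h3 : eta * - (eta * log2 eta) <= eta * (ln 2)^-1 by rewrite ler_pM2l.
have h4 : eta * eta * (ln 2)^-1 <= 2^-1 * eta * (ln 2)^-1 by rewrite ler_pM2r.
have h5 : 0 < eta * (ln 2)^-1 by rewrite mulr_gt0.
lra.
Qed.

(** One [eps] comes from the secrecy ratio and one from Fano's inequality; both bounds are then
    divided by [n]. *)
Lemma achievable_slack (R : realType) (X Y Z S : finType)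
  (pS : S -> R) (W : S -> X -> Y -> Z -> R) (Rf Rt eps : R) :
  is_pmf pS -> valid_channel W -> securely_achievable pS W Rf Rt ->
  0 < eps -> eps < 2^-1 ->
  exists q, (forall s, is_pmf (q s)) /\
    (1 - 2 * eps) * Rt <= upper_bound_expr pS W Rf q + fano_slack eps.
Proof.
move=> pS_pmf W_pmf ach e0 e1; have [n [c [rate [secr err]]]] := ach eps e0.
(* If [H(M) = 0], the ratio is a division by zero, hence 0, which is below [1 - eps]. *)
have H_neq0 : Hrv (@code_joint _ _ _ _ _ _ _ pS W c) (@rvM _ _ _ _ _ _ _ c) != 0.
  by apply: contraTneq secr => e; rewrite /secrecy_ratio e invr0 mulr0 -ltNge; lra.
have [w0 _|Om0] := pickP (fun _ : omega Z c => true); last first.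
  move: H_neq0; rewrite HrvE big_pred0 ?oppr0 ?eqxx // => w; exact: Om0.
have LE := Hrv_message pS_pmf W_pmf w0.
(* Block length 0 leaves a single message, hence [H(M) = 0]. *)
have n_gt0 : (0 < n)%N.
  rewrite lt0n; apply: contra_neq H_neq0 => n0; rewrite LE /msg_size n0 mul0r powRr0.
  by rewrite ceil1 log21.
have nr_gt0 : 0 < n%:R :> R by rewrite ltr0n.
have L_gt0 : 0 < @log2 R (msg_size n Rt)%:R.
  rewrite lt_def -LE H_neq0 LE -(log21 R) ler_log2 // ler1n.
  exact: leq_ltn_trans (ltn_ord (seqM w0)).
have L_ge := log2_msg_size n Rt.
have e_lt1 : eps < 1 by lra.
have slack_ge0 := fano_slack_ge0 e0 e_lt1.
have slack_n : fano_slack eps <= n%:R * fano_slack eps by rewrite ler_peMl // ler1n.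
have secB := code_secrecy_bound pS_pmf W_pmf n_gt0 w0 e0 e_lt1 err.
have relB := code_reliability_bound pS_pmf W_pmf n_gt0 w0 e0 e_lt1 err.
rewrite /secrecy_ratio LE ler_pdivlMr // in secr.
rewrite /fb_rate_ok ler_pdivrMl // in rate.
exists (avg_input c pS W); split; first exact: avg_input_pmf.
have RtL : (1 - 2 * eps) * (n%:R * Rt) <= (1 - 2 * eps) * log2 (msg_size n Rt)%:R.
  by rewrite ler_wpM2l //; lra.
have eL : 0 < eps * log2 (msg_size n Rt)%:R by rewrite mulr_gt0.
rewrite -lerBlDr /upper_bound_expr le_min; apply/andP; split.
  rewrite -(ler_pM2l nr_gt0); move: secB; set i1 := cmi _ _ _ _; set i2 := condH _ (@rvS _ _ _ _) _.
  set cM := condH _ _ _ in secr *; lra.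
rewrite -(ler_pM2l nr_gt0); move: relB; set i1 := cmi _ _ _ _; lra.
Qed.

Lemma ler_linear_slack (R : realType) (C a b : R) :
  (forall t, 0 < t -> t <= 2^-1 -> a <= b + C * t) -> a <= b.
Proof.
move=> h; have [//|ba] := leP a b.
have C1 : 0 < `|C| + 1 by rewrite ltr_wpDl.
(* Chosen so that [C * t] is at most half of the supposed gap [a - b]. *)
pose t := Num.min 2^-1 ((a - b) / 2 / (`|C| + 1)).
have t0 : 0 < t by rewrite lt_min !divr_gt0 ?invr_gt0 //; lra.
have := h t t0; rewrite ge_min lexx => /(_ isT).
have : C * t <= (`|C| + 1) * t by rewrite ler_pM2r //; have := ler_norm C; lra.
have : t * (`|C| + 1) <= (a - b) / 2 by rewrite -ler_pdivlMr // ge_min lexx orbT.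
lra.
Qed.

Theorem theorem2 (R : realType) (X Y Z S : finType)
  (pS : S -> R) (W : S -> X -> Y -> Z -> R) (Rf : R) :
  is_pmf pS -> valid_channel W ->
  forall Rt : R, securely_achievable pS W Rf Rt ->
  exists q : S -> X -> R,
    (forall s, is_pmf (q s)) /\ Rt <= upper_bound_expr pS W Rf q.
Proof.
move=> pS_pmf W_pmf Rt ach.
have slack eps := @achievable_slack R X Y Z S pS W Rf Rt eps pS_pmf W_pmf ach.
(* Any value below [2^-1] would do: this only provides some input law, so that the maximum
   exists. *)
have [||q0 [q0P _]] := slack (3^-1); [lra|lra|].
(* The law given by [slack] varies with [eps]; the maximiser [q] dominates all of them. *)
have [q [qP qmax]] := @upper_bound_expr_max R X Y Z S pS W Rf q0 q0P.
exists q; split=> //.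
(* With [eps = t ^+ 2], the term [|Rt|] absorbs the loss [2 * eps * Rt], and [4 / ln 2] comes from
   [fano_slack_sqr]. *)
apply: (@ler_linear_slack _ (`|Rt| + 4 / ln 2)) => t t0 t1.
have tt : t ^+ 2 <= 2^-1 * t by rewrite expr2 ler_pM2r.
have [||q' [q'P h]] := slack (t ^+ 2); [by rewrite exprn_gt0|lra|].
have hq := qmax q' q'P; have hs := fano_slack_sqr t0 t1.
have : 2 * t ^+ 2 * Rt <= t * `|Rt|.
  apply: (@le_trans _ _ (2 * t ^+ 2 * `|Rt|)).
    by rewrite ler_wpM2l ?ler_norm // mulr_ge0 // sqr_ge0.
  by rewrite ler_wpM2r //; lra.
lra.
Qed.
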